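(* Let $\Delta$ be the clique complex of a chordal graph with at least two maximal cliques, with facets $S_1,\ldots,S_e$ in a fixed leaf order, separator cardinalities $r_1,\ldots,r_{e-1}$, $r_{\min}=\min_m r_m$, number of vertices $N$, and $d=\dim\Delta$. Let $-1\le k\le d$. Then $$\operatorname{reg}\mathbb K[\Delta_{(k)}]=\begin{cases}k+1,&-1\le k<d,\\ 1,&k=d,\end{cases}$$ and $$\operatorname{pdim}\mathbb K[\Delta_{(k)}]=\begin{cases}N-k-1,&-1\le k\le r_{\min},\\ N-r_{\min}-1,&r_{\min}<k\le d.\end{cases}$$ Consequently, $$\operatorname{depth}\mathbb K[\Delta_{(k)}]=\begin{cases}k+1,&-1\le k\le r_{\min},\\ r_{\min}+1,&r_{\min}<k\le d.\end{cases}$$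
   Context: $\mathbb K$ is a field. For a finite set $X$ with $|X|=N$, put $R=\mathbb K[x:x\in X]$ with the standard grading. A simplicial complex $\Sigma$ on $X$ is a collection of subsets (faces) of $X$ closed under inclusion; elements of $X$ not lying in any face (ghost vertices) are allowed. Facets are the maximal faces, a face $F$ has dimension $|F|-1$, and $\dim\Sigma$ is the largest dimension of a face. The $k$-skeleton $\Sigma_{(k)}$ consists of all faces of dimension at most $k$, viewed as a complex on the same set $X$; $\Sigma_{(-1)}=\{\varnothing\}$. $I_\Sigma\subseteq R$ is generated by the monomials $\prod_{x\in A}x$ with $A\subseteq X$, $A\notin\Sigma$; $\mathbb K[\Sigma]=R/I_\Sigma$. Projective dimension $\operatorname{pdim}$ and Castelnuovo–Mumford regularity $\operatorname{reg}M=\max\{j-i:\beta_{i,j}(M)\ne0\}$ are taken over $R$. Chordal clique complexes: let $\Delta$ be the complex of cliques of a finite chordal graph with vertex set $X$, $|X|=N$, having $e\ge2$ maximal cliques. A leaf order of its facets (maximal cliques) is an ordering $S_1,\ldots,S_e$ such that for each $m\ge2$ there is $p(m)<m$ satisfying $S_m\cap S_i\subseteq S_m\cap S_{p(m)}$ for all $i<m$; such an order exists. For $1\le m\le e-1$ the separators are $Q_m=(S_1\cup\cdots\cup S_m)\cap S_{m+1}=S_{p(m+1)}\cap S_{m+1}$ (possibly empty), and $r_m=|Q_m|$. One has $N=\sum_{m=1}^e |S_m|-\sum_{m=1}^{e-1}r_m$ and $d=\dim\Delta=\max_m |S_m|-1$. *)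

(* Defs.v *)
From HB Require Import structures.
From mathcomp Require Import all_boot all_order all_algebra.
From mathcomp Require Import mpoly.
From Stdlib Require Import ClassicalEpsilon.

Set Implicit Arguments.
Unset Strict Implicit.
Unset Printing Implicit Defensive.
Import Order.TTheory GRing.Theory Num.Theory.
Local Open Scope ring_scope.
Local Open Scope quotient_scope.

(* Relations rather than functions: the extremum has to exist and be attained. *)
Definition is_least (P : int -> Prop) (m : int) : Prop :=
  P m /\ forall z, P z -> m <= z.

Definition is_greatest (P : int -> Prop) (m : int) : Prop :=
  P m /\ forall z, P z -> z <= m.

Section Combinatorics.
Variable X : finType.

(* A simplicial complex on X is given by its set of faces; a point of X lying
   in no face is a ghost vertex. *)

Definition facets (D : {set {set X}}) : {set {set X}} :=
  [set F | maxset (mem D) F].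

Definition complex_dim (D : {set {set X}}) : int :=
  (\max_(F in D) #|F|)%N%:Z - 1.

Definition skeleton (D : {set {set X}}) (k : int) : {set {set X}} :=
  [set F in D | #|F|%:Z - 1 <= k].

(* Every cycle of length at least 4 has a chord: an edge joining two vertices
   that are not consecutive on the cycle. *)
Definition chordal (adj : rel X) : Prop :=
  forall c : seq X, (3 < size c)%N -> uniq c -> cycle adj c ->
  exists x y, [/\ x \in c, y \in c, adj x y, y != next c x & x != next c y].

Definition clique_complex (adj : rel X) : {set {set X}} :=
  [set A : {set X} | [forall x in A, forall y in A, (x != y) ==> adj x y]].

(* Positions are counted from 0. *)
Definition leaf_order (D : {set {set X}}) (S : seq {set X}) : Prop :=
  perm_eq S (enum (facets D)) /\
  forall m, (0 < m < size S)%N -> exists2 p, (p < m)%N &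
    forall i, (i < m)%N ->
      nth set0 S m :&: nth set0 S i \subset nth set0 S m :&: nth set0 S p.

(* [separator S m] is (S_0 :|: ... :|: S_m) :&: S_(m+1), for m + 1 < size S. *)
Definition separator (S : seq {set X}) (m : nat) : {set X} :=
  (\bigcup_(i < m.+1) nth set0 S i) :&: nth set0 S m.+1.

(* The default value #|X| bounds every separator cardinality, so it is
   irrelevant as soon as there is a separator, i.e. when 1 < size S. *)
Definition r_min (S : seq {set X}) : nat :=
  \big[minn/#|X|]_(m < (size S).-1) #|separator S m|.

End Combinatorics.

Section QuotientModule.
Variables (R : nzRingType) (M : lmodType R) (S : submodClosed M).

(* [submodClosed] does not by itself provide closure under opposite. *)
Definition submod_pred : {pred M} := S.

HB.instance Definition _ :=
  GRing.isSubmodClosed.Build R M submod_pred (GRing.submodClosedP S).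

Definition modquot : Type := Quotient.quot submod_pred.
HB.instance Definition _ := GRing.Zmodule.on modquot.

Definition modquot_pi (x : M) : modquot := \pi_(Quotient.quot submod_pred) x.

Lemma modquot_piP (x y : M) : modquot_pi x = modquot_pi y <-> x - y \in S.
Proof.
rewrite (Quotient.idealrBE submod_pred); split; first by move=> h; apply/eqP.
by move/eqP.
Qed.

Lemma modquot_pi_surj (q : modquot) : exists x, q = modquot_pi x.
Proof. by exists (repr (q : Quotient.quot submod_pred)); rewrite /modquot_pi reprK. Qed.

Lemma modquot_piD : {morph modquot_pi : x y / x + y}.
Proof. by move=> x y; rewrite /modquot_pi raddfD. Qed.

Definition modquot_scale (a : R) (q : modquot) : modquot :=
  modquot_pi (a *: repr (q : Quotient.quot submod_pred)).

Lemma modquot_scaleE a x : modquot_scale a (modquot_pi x) = modquot_pi (a *: x).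
Proof.
apply/modquot_piP; rewrite -scalerBr; apply: rpredZ.
by apply/modquot_piP; rewrite /modquot_pi reprK.
Qed.

Let scaleA a b q :
  modquot_scale a (modquot_scale b q) = modquot_scale (a * b) q.
Proof.
by case: (modquot_pi_surj q) => x ->; rewrite !modquot_scaleE scalerA.
Qed.

Let scale1 : left_id 1 modquot_scale.
Proof.
by move=> q; case: (modquot_pi_surj q) => x ->; rewrite modquot_scaleE scale1r.
Qed.

Let scaleDr : right_distributive modquot_scale +%R.
Proof.
move=> a p q; case: (modquot_pi_surj p) (modquot_pi_surj q) => x -> [y ->].
by rewrite -modquot_piD !modquot_scaleE scalerDr modquot_piD.
Qed.

Let scaleDl q : {morph modquot_scale^~ q : a b / a + b}.
Proof.
move=> a b; case: (modquot_pi_surj q) => x ->.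
by rewrite !modquot_scaleE scalerDl modquot_piD.
Qed.

HB.instance Definition _ :=
  GRing.Zmodule_isLmodule.Build R modquot scaleA scale1 scaleDr scaleDl.

Lemma modquot_pi_is_linear : linear modquot_pi.
Proof. by move=> a x y; rewrite modquot_piD -modquot_scaleE. Qed.

HB.instance Definition _ :=
  GRing.isLinear.Build R M modquot *:%R modquot_pi modquot_pi_is_linear.

End QuotientModule.

Section ProjectiveDimension.
Variable R : nzRingType.

Definition projective (P : lmodType R) : Prop :=
  forall (A B : lmodType R) (f : {linear A -> B}) (g : {linear P -> B}),
    (forall b, exists a, f a = b) ->
    exists h : {linear P -> A}, forall x, f (h x) = g x.

(* 0 -> P_l -> ... -> P_1 -> P_0 -> M -> 0 *)
Definition has_projective_resolution (M : lmodType R) (l : nat) : Prop :=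
  exists (P : nat -> lmodType R) (d : forall i, {linear P i.+1 -> P i})
         (eps : {linear P 0%N -> M}),
    [/\ forall i, projective (P i),
        forall i, (l < i)%N -> forall x : P i, x = 0,
        forall m, exists x, eps x = m,
        forall x, eps x = 0 <-> exists y, d 0%N y = x &
        forall i x, d i x = 0 <-> exists y, d i.+1 y = x].

Definition is_pdim (M : lmodType R) : int -> Prop :=
  is_least (fun z => exists2 l : nat, z = l%:Z & has_projective_resolution M l).

End ProjectiveDimension.

Section Depth.
Variables (R : comNzRingType) (M : lmodType R).

(* the submodule (f_1, ..., f_s) M *)
Definition seq_smul (fs : seq R) (m : M) : Prop :=
  exists v : 'I_(size fs) -> M, m = \sum_(i < size fs) fs`_i *: v i.

Definition regular_sequence (fs : seq R) : Prop :=
  (forall i, (i < size fs)%N -> forall m : M,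
     seq_smul (take i fs) (fs`_i *: m) -> seq_smul (take i fs) m) /\
  exists m : M, ~ seq_smul fs m.

Definition is_depth (mm : R -> Prop) : int -> Prop :=
  is_greatest (fun z => exists fs : seq R,
    [/\ forall f, f \in fs -> mm f, regular_sequence fs & z = (size fs)%:Z]).

End Depth.

Section GradedBetti.
Variables (K : fieldType) (n : nat).
Local Notation R := {mpoly K[n]}.

Definition irrelevant_ideal (p : R) : Prop := p@_0%MM = 0.

Definition is_homogeneous (z : int) (p : R) : Prop :=
  if z is Posz d then p \is d.-homog else p = 0.

(* A sequence of graded free modules F_i = \bigoplus_a R(- gdeg i a), with a
   basis indexed by 'I_(grank i), and of R-linear maps F_(i+1) -> F_i. An
   element of F_i is a row vector, and the map is right multiplication by
   gdiff i. *)
Record gfree := GFree {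
  grank : nat -> nat;
  gdeg : forall i, 'I_(grank i) -> int;
  gdiff : forall i, 'M[R]_(grank i.+1, grank i) }.

(* [piece j] is the degree j component of the graded module M. *)
Variables (M : lmodType R) (piece : int -> M -> Prop).

Definition is_graded_free_resolution (F : gfree) : Prop :=
  exists eps : {linear 'rV[R]_(grank F 0) -> M},
    [/\ (forall a, piece (gdeg a) (eps (delta_mx 0 a))) /\
        (forall i a b, is_homogeneous (gdeg a - gdeg b) (gdiff F i a b)),
        forall m, exists v, eps v = m,
        forall v, eps v = 0 <-> exists w, w *m gdiff F 0 = v &
        forall i (v : 'rV_(grank F i.+1)),
          v *m gdiff F i = 0 <-> exists w, w *m gdiff F i.+1 = v].

Definition is_minimal_resolution (F : gfree) : Prop :=
  is_graded_free_resolution F /\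
  forall i a b, irrelevant_ideal (gdiff F i a b).

(* A chosen one; minimal graded free resolutions are unique up to isomorphism. *)
Definition minimal_resolution : gfree :=
  epsilon (inhabits (@GFree (fun=> 0%N) (fun _ _ => 0) (fun=> 0)))
          is_minimal_resolution.

Definition betti (i : nat) (j : int) : nat :=
  #|[set a : 'I_(grank minimal_resolution i) | gdeg a == j]|.

Definition is_reg : int -> Prop :=
  is_greatest (fun z => exists (i : nat) (j : int),
    betti i j <> 0%N /\ z = j - i%:Z).

End GradedBetti.

Section StanleyReisner.
Variables (K : fieldType) (X : finType).

(* The variable attached to x : X is 'X_(enum_rank x). *)
Local Notation R := {mpoly K[#|X|]}.

Definition face_monomial (A : {set X}) : R := \prod_(x in A) 'X_(enum_rank x).

Variable D : {set {set X}}.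

Definition in_SR_ideal (p : R) : Prop :=
  exists c : {set X} -> R, p = \sum_(A | A \notin D) c A * face_monomial A.

(* R^o is R as a module over itself. *)
Definition SR_ideal : {pred R^o} :=
  fun p => is_left (excluded_middle_informative (in_SR_ideal p)).

Lemma SR_idealP (p : R) : reflect (in_SR_ideal p) ((p : R^o) \in SR_ideal).
Proof. exact: sumboolP. Qed.

Lemma SR_ideal_submod_closed : GRing.submod_closed SR_ideal.
Proof.
split; first by apply/SR_idealP; exists (fun=> 0); rewrite big1 // => A _; rewrite mul0r.
move=> a p q /SR_idealP[c ->] /SR_idealP[c' ->]; apply/SR_idealP.
exists (fun A => a * c A + c' A); rewrite /GRing.scale /= mulr_sumr -big_split /=.
by apply: eq_bigr => A _; rewrite mulrDl mulrA.
Qed.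

HB.instance Definition _ :=
  GRing.isSubmodClosed.Build R R^o SR_ideal SR_ideal_submod_closed.

Definition SR_module : lmodType R := modquot SR_ideal.

Definition SR_piece (j : int) (m : SR_module) : Prop :=
  exists2 p : R, is_homogeneous j p & m = modquot_pi SR_ideal p.

Definition SR_is_reg : int -> Prop := is_reg SR_piece.
Definition SR_is_pdim : int -> Prop := is_pdim SR_module.
Definition SR_is_depth : int -> Prop :=
  is_depth SR_module (@irrelevant_ideal K #|X|).

End StanleyReisner.

(* Main.v *)
Require Import Defs.
From HB Require Import structures.
From mathcomp Require monalg.
From mathcomp Require Import mpoly.
From mathcomp Require Import all_boot all_order all_algebra zify ring.
From Stdlib Require Import Classical ClassicalEpsilon.

(** Koszul homology of the variables with values in the Stanley-Reisner ring M of
    the skeleton computes the three invariants. Write H(i, q) for its part of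
    homological degree i and internal degree i + q, and N for the number of
    vertices. In a minimal graded free resolution the i-th module has a generator
    of degree i + q exactly when H(i, q) is nonzero [minimal_generator_degree]:
    this is dimension shifting along the resolution. Hence the regularity is the
    largest q, and the projective dimension the largest i, with H(i, q) nonzero.
    Any projective resolution of length l forces vanishing for i > l, because
    projective modules have no higher Koszul homology [koszul_exact_pdim]. A
    regular sequence of length s in the irrelevant ideal forces vanishing for
    i > N - s, because that ideal annihilates the homology
    [koszul_exact_regular]. Minimal resolutions exist because vanishing for large
    q bounds the degrees of the generators of every syzygy module
    [submodule_finite], and a graded piece has finite dimension.

    The upper bounds come from a filtration. Suppose that a complex is obtained by
    adding intervals of faces [G, F], one after the other and with a complex at
    each step. Each step adds to the Stanley-Reisner ring a copy of the polynomial
    ring on F, shifted by the size of G; its homology H(i, q) is zero for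
    i > N - #|F| and for q > #|G| [step_exact], and these vanishing results pass
    to extensions. So do regular sequences [weakly_regular_trans]; one sequence
    that works over every field and for all faces F with at least t vertices is
    that of the first t elementary symmetric polynomials in all the variables
    [elem_sym_weakly_regular]. For the k-skeleton of a complex whose facets have a
    leaf order, add the facets in this order and the vertices of a facet outside
    its separator one at a time. With l = k + 1, all F have at least
    t = min(l, r_min + 1) vertices, and the G have at most l vertices, or at most
    1 when no facet has more than l of them [interval_built_initial_skel].

    It remains to exhibit nonzero classes. A minimal nonface with a vertices gives
    H(1, a - 1); this is the regularity. If k < r_min, a face of the complex with
    k + 2 vertices is a minimal nonface of the skeleton and gives H(N - k - 1, k + 1)
    [SR_exact_minimal_nonface]. Otherwise a smallest separator disconnects the
    remaining N - r_min vertices [separator_disconnects], which gives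
    H(N - r_min - 1, 1) [SR_exact_disconnected]. *)

Set Implicit Arguments.
Unset Strict Implicit.
Unset Printing Implicit Defensive.
Import Order.TTheory GRing.Theory Num.Theory.
Local Open Scope ring_scope.

(** * The Koszul differential *)

Section KoszulDifferential.
Variables (K : fieldType) (n : nat).
Local Notation R := {mpoly K[n]}.

Definition ksign (v : 'I_n) (A : {set 'I_n}) : R :=
  (-1) ^+ #|[set w in A | (w < v)%N]|.

(** The differential of the Koszul complex of the variables with values in [L].
    A chain of degree [i] is a function of the exterior monomials e_A, of which
    only the values at [#|A| = i] count: one type serves for all degrees. *)
Definition kdiff (L : lmodType R) (c : {set 'I_n} -> L) (A : {set 'I_n}) : L :=
  \sum_(v | v \notin A) (ksign v A * 'X_v) *: c (v |: A).

Lemma ksignU (v u : 'I_n) (A : {set 'I_n}) : u \notin A ->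
  ksign v (u |: A) = (-1) ^+ (u < v)%N * ksign v A.
Proof.
move=> uA; rewrite /ksign -exprD; congr (_ ^+ _).
case: ltnP => uv.
  have -> : [set w in u |: A | (w < v)%N] = u |: [set w in A | (w < v)%N].
    by apply/setP => w; rewrite !inE andb_orl; case: eqP => // ->; rewrite uv.
  by rewrite cardsU1 inE (negbTE uA).
apply: eq_card => w; rewrite !inE; case: eqP => // ->.
by rewrite (negbTE uA) ltnNge uv.
Qed.

Lemma ksign_sq (v : 'I_n) (A : {set 'I_n}) : ksign v A * ksign v A = 1.
Proof. by rewrite /ksign -expr2 sqrr_sign. Qed.

Lemma ksign_comm (u v : 'I_n) (A : {set 'I_n}) : u != v -> u \notin A -> v \notin A ->
  ksign u (v |: A) * ksign v A = - (ksign v (u |: A) * ksign u A).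
Proof.
move=> uv uA vA; rewrite !ksignU // -!mulrA [ksign v A * _]mulrC -mulNr.
congr (_ * _); case: (ltngtP u v) => [_|_|/val_inj e]; last by rewrite e eqxx in uv.
- by rewrite expr0 expr1 opprK.
- by rewrite expr0 expr1.
Qed.

(** Pairing the term at [(u, v)] with the one at [(v, u)] works in every
    characteristic, 2 included. *)
Lemma antisym_sum0 (V : zmodType) (P : rel 'I_n) (F : 'I_n -> 'I_n -> V) :
  ssrbool.symmetric P -> (forall u v, u != v -> P u v -> F u v = - F v u) ->
  \sum_u \sum_(v | P u v && (u != v)) F u v = 0.
Proof.
move=> Psym Fanti.
have split_lt (u : 'I_n) : \sum_(v | P u v && (u != v)) F u v
   = \sum_(v | P u v && (u < v)%N) F u v + \sum_(v | P u v && (v < u)%N) F u v.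
  rewrite (bigID (fun v : 'I_n => (u < v)%N)) /=; congr (_ + _); apply: eq_bigl => v;
  rewrite -andbA; case: (ltngtP u v) => [||/val_inj ->];
  by rewrite ?eqxx ?andbF //= neq_ltn => ->; rewrite ?orbT.
rewrite (eq_bigr _ (fun u _ => split_lt u)) big_split /=.
rewrite [X in _ + X](exchange_big_dep predT) //= -big_split big1 // => u _ /=.
rewrite -(eq_bigl _ _ (fun v => congr1 (andb^~ _) (Psym u v))) -big_split.
rewrite big1 //= => v /andP[Puv uv].
by rewrite Fanti ?neq_ltn ?uv // addNr.
Qed.

Section Linear.
Variable L : lmodType R.
Implicit Types (c : {set 'I_n} -> L) (A B : {set 'I_n}).

Lemma eq_kdiff c c' A : (forall B, #|B| = #|A|.+1 -> c B = c' B) ->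
  kdiff c A = kdiff c' A.
Proof. by move=> e; apply: eq_bigr => v vA; rewrite e // cardsU1 vA. Qed.

Lemma kdiffD c c' A : kdiff (fun B => c B + c' B) A = kdiff c A + kdiff c' A.
Proof. by rewrite -big_split; apply: eq_bigr => v _; rewrite scalerDr. Qed.

Lemma kdiffB c c' A : kdiff (fun B => c B - c' B) A = kdiff c A - kdiff c' A.
Proof. by rewrite -sumrB; apply: eq_bigr => v _; rewrite scalerBr. Qed.

Lemma kdiffZ (a : R) c A : kdiff (fun B => a *: c B) A = a *: kdiff c A.
Proof.
by rewrite scaler_sumr; apply: eq_bigr => v _; rewrite !scalerA [a * _]mulrC.
Qed.

Lemma kdiff_linear (L' : lmodType R) (f : {linear L -> L'}) c A :
  f (kdiff c A) = kdiff (fun B => f (c B)) A.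
Proof. by rewrite linear_sum; apply: eq_bigr => v _; rewrite linearZ. Qed.

Lemma kdiff_kdiff c A : kdiff (kdiff c) A = 0.
Proof.
pose F (v u : 'I_n) : L :=
  (ksign v A * ksign u (v |: A) * ('X_v * 'X_u)) *: c (u |: (v |: A)).
rewrite -[RHS](@antisym_sum0 _ (fun v u => (v \notin A) && (u \notin A)) F).
- rewrite /kdiff big_mkcond; apply: eq_bigr => v _; case: ifP => vA /=; last by rewrite big_pred0.
  rewrite scaler_sumr; apply: eq_big => [u|u _].
    by rewrite !inE negb_or andbC eq_sym.
  by rewrite scalerA mulrACA.
- by move=> u v; rewrite andbC.
move=> u v uv /andP[uA vA]; rewrite /F setUCA -scaleNr; congr (_ *: _).
rewrite -mulNr; congr (_ * _); last by rewrite mulrC.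
by rewrite mulrC ksign_comm ?(eq_sym v) // mulrC.
Qed.

End Linear.
End KoszulDifferential.

(** * Exactness of Koszul complexes *)

Section Acyclicity.
Variables (K : fieldType) (n : nat).
Local Notation R := {mpoly K[n]}.
Implicit Types (u v : 'I_n) (A B : {set 'I_n}).

(** The Koszul homology of [L / Q] vanishes in degree [i], for the classes of the
    chains with values in [P], which bound chains with values in [P']. Submodules
    and graded pieces are predicates on one ambient module, so that no quotient
    has to be formed; an unrestricted [P'] costs nothing when [Q] is graded, as
    a bounding chain may be replaced by its homogeneous component. *)
Definition koszul_exact (L : lmodType R) (i : nat) (P P' Q : L -> Prop) : Prop :=
  forall c : {set 'I_n} -> L,
    (forall A, #|A| = i -> P (c A)) ->
    (forall A, #|A|.+1 = i -> Q (kdiff c A)) ->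
  exists c', (forall A, #|A| = i.+1 -> P' (c' A)) /\
             (forall A, #|A| = i -> Q (c A - kdiff c' A)).

Section Homotopy.
Variables (L : lmodType R).
Implicit Types (c : {set 'I_n} -> L).

(** Exterior multiplication by e_v, with [T] applied to the values. *)
Definition khomotopy (T : L -> L) v c A : L :=
  if v \in A then ksign K v (A :\ v) *: T (c (A :\ v)) else 0.

Lemma ksignZ_additive (T : {additive L -> L}) v A (y : L) :
  T (ksign K v A *: y) = ksign K v A *: T y.
Proof.
by rewrite /ksign -signr_odd; case: (odd _); rewrite ?expr0 ?expr1 ?scaleN1r ?raddfN ?scale1r.
Qed.

(** For [T] the identity both branches are multiplication by ['X_v]; for [T] the
    division by ['X_v] the first one is the identity. *)
Lemma khomotopyE (T : {additive L -> L}) v c A :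
  (forall u y, u != v -> T ('X_u *: y) = 'X_u *: T y) ->
  kdiff (khomotopy T v c) A + khomotopy T v (kdiff c) A =
    if v \in A then T ('X_v *: c A) else 'X_v *: T (c A).
Proof.
move=> TX; case: ifP => vA; last first.
  rewrite {2}/khomotopy vA addr0 /kdiff (bigD1 v) ?vA //= [X in _ + X]big1 ?addr0.
    rewrite /khomotopy setU11 setU1K ?vA // scalerA mulrAC ksign_sq mul1r.
    by [].
  move=> u /andP[uA uv]; rewrite /khomotopy !inE eq_sym (negbTE uv) vA.
  by rewrite scaler0.
set A' := A :\ v; have vA' : v \notin A' by rewrite !inE eqxx.
have AE : A = v |: A' by rewrite setD1K.
rewrite {2}/khomotopy vA -/A' {2}/kdiff (bigD1 v vA') /= raddfD scalerDr.
rewrite -AE -scalerA ksignZ_additive scalerA ksign_sq scale1r addrCA.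
rewrite raddf_sum scaler_sumr.
suff -> : kdiff (khomotopy T v c) A = - \sum_(u | (u \notin A') && (u != v))
    ksign K v A' *: T ((ksign K u A' * 'X_u) *: c (u |: A')).
  by rewrite addNr addr0.
rewrite /kdiff -sumrN; apply: eq_big => [u|u uA].
  by rewrite AE !inE negb_or andbC; case: (u =P v) => //= ->; rewrite eqxx.
have uv : u != v by apply: contraNneq uA => ->.
have uA' : u \notin A' by rewrite !inE uv.
rewrite /khomotopy !inE vA orbT.
have -> : (u |: A) :\ v = u |: A'.
  by apply/setP => w; rewrite !inE; case: (w =P v) => [->|]; rewrite ?andbF //= eq_sym (negbTE uv).
rewrite -[_ *: c (u |: A')]scalerA (ksignZ_additive T) TX // !scalerA -scaleNr; congr (_ *: _).
rewrite {1}AE !ksignU //.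
case: (ltngtP u v) => [_|_|/val_inj e]; last by rewrite e eqxx in uv.
- by rewrite /=; ring.
- by rewrite /=; ring.
Qed.

Definition is_submodule (Q : L -> Prop) : Prop :=
  [/\ Q 0, forall x y, Q x -> Q y -> Q (x + y) & forall (a : R) x, Q x -> Q (a *: x)].

Lemma submodB (Q : L -> Prop) x y : is_submodule Q -> Q x -> Q y -> Q (x - y).
Proof. by case=> _ QD QZ Qx Qy; rewrite -scaleN1r; apply: QD => //; apply: QZ. Qed.

Lemma submod_kdiff (Q : L -> Prop) c A : is_submodule Q ->
  (forall B, #|B| = #|A|.+1 -> Q (c B)) -> Q (kdiff c A).
Proof.
case=> Q0 QD QZ Qc; apply: (big_ind Q) => // v vA; apply: QZ; apply: Qc.
by rewrite cardsU1 vA.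
Qed.

(** The irrelevant ideal annihilates Koszul homology: each variable is
    null-homotopic, and a polynomial without constant term is a combination of
    variables. *)
Lemma irrelevant_boundary (Q : L -> Prop) (f : R) i c :
  is_submodule Q -> irrelevant_ideal f ->
  (forall A, #|A|.+1 = i -> Q (kdiff c A)) ->
  exists b, forall A, #|A| = i -> Q (f *: c A - kdiff b A).
Proof.
move=> Qmod f0 cyc; have [Q0 QD QZ] := Qmod.
pose good (g : R) := exists b, forall A, #|A| = i -> Q (g *: c A - kdiff b A).
have goodX (v : 'I_n) : good 'X_v.
  exists (khomotopy (@idfun L) v c) => A cA.
  have /= := @khomotopyE (@idfun L) v c A (fun u y _ => erefl); rewrite if_same => <-.
  rewrite addrC addKr /khomotopy; case: ifP => // vA; apply: QZ; apply: cyc.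
  by rewrite -cA (cardsD1 v A) vA.
have goodM (a g : R) : good g -> good (a * g).
  case=> b bE; exists (fun B => a *: b B) => A cA.
  by rewrite kdiffZ -scalerA -scalerBr; apply: QZ; apply: bE.
rewrite -/(good f) (mpolyE f) big_seq.
apply: (big_ind good).
- exists (fun=> 0) => A _; rewrite scale0r sub0r -sub0r; apply: submodB => //.
  by apply: submod_kdiff.
- move=> g h [b bE] [b' bE']; exists (fun B => b B + b' B) => A cA.
  by rewrite kdiffD scalerDl opprD addrACA; apply: QD; [apply: bE|apply: bE'].
move=> m mf; have /eqP mN0 : m != 0%MM.
  by apply: contraTneq mf => ->; rewrite mcoeff_msupp f0 eqxx.
have [v mv] : exists v, (m v != 0)%N.
  case: (pickP (fun v => m v != 0%N)) => [v mv|m0]; first by exists v.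
  by case: mN0; apply/mnmP => v; rewrite mnm0E; apply/eqP; rewrite -[_ == _]negbK m0.
rewrite -mul_mpolyC -(@submK _ U_(v)%MM m); last by rewrite lep1mP.
by rewrite mpolyXD mulrA; apply: goodM; apply: goodX.
Qed.

(** Operators that divide by each variable: [T v] cancels ['X_v] and is linear
    in the other variables. They exist on every free module and are inherited
    by direct summands, hence exist on every projective module. *)
Definition divides_variables (T : 'I_n -> {additive L -> L}) : Prop :=
  forall v, (forall y, T v ('X_v *: y) = y) /\
            (forall u y, u != v -> T v ('X_u *: y) = 'X_u *: T v y).

(** With [T v] as homotopy the identity is homotopic to a map that is zero on
    every index set containing [v]; composing over all [v] kills everything
    but the component at the empty set. *)
Lemma koszul_acyclic (T : 'I_n -> {additive L -> L}) i :
  divides_variables T -> (0 < i)%N ->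
  koszul_exact i (fun=> True) (fun=> True) (fun x : L => x = 0).
Proof.
move=> Tdiv i0 c _ cyc.
have zero_mod : is_submodule (fun x : L => x = 0).
  by split=> [//|x y -> ->|a x ->]; rewrite ?addr0 ?scaler0.
suff step : forall s : seq 'I_n, exists c1 c',
   [/\ forall A, #|A| = i -> c A = c1 A + kdiff c' A,
       forall A, #|A|.+1 = i -> kdiff c1 A = 0 &
       forall A, #|A| = i -> has (fun v => v \in A) s -> c1 A = 0].
  have [c1 [c' [c1E _ c10]]] := step (enum 'I_n); exists c'; split=> // A cA.
  rewrite c1E // addrK c10 //; have /card_gt0P[v vA] : (0 < #|A|)%N by rewrite cA.
  by apply/hasP; exists v; rewrite ?mem_enum.
elim=> [|v s [c1 [c' [c1E cyc1 c10]]]].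
  exists c, (fun=> 0); split=> // A cA.
  by rewrite (submod_kdiff (Q := fun x => x = 0)) ?addr0.
have [TK TX] := Tdiv v.
pose h := khomotopy (T v) v c1.
have hE A : #|A| = i -> kdiff h A = if v \in A then c1 A else 'X_v *: T v (c1 A).
  move=> cA; have := khomotopyE c1 A TX; rewrite TK => <-.
  rewrite {2}/khomotopy; case: ifP => vA; last by rewrite addr0.
  by rewrite cyc1 ?raddf0 ?scaler0 ?addr0 // -cA (cardsD1 v A) vA.
exists (fun A => c1 A - kdiff h A), (fun A => c' A + h A); split=> A cA.
- by rewrite c1E // kdiffD [kdiff c' A + _]addrC addrA subrK.
- by rewrite kdiffB kdiff_kdiff subr0 cyc1.
rewrite /= hE //; case: ifP => [_ _|_ /= As]; first by rewrite subrr.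
by rewrite c10 // raddf0 scaler0 subr0.
Qed.

End Homotopy.
End Acyclicity.

(** * Division by variables on free and projective modules *)

Section Divisions.
Variables (K : fieldType) (n : nat).
Local Notation R := {mpoly K[n]}.
Implicit Types (u v : 'I_n) (A B : {set 'I_n}).

Lemma mcoeff_XM (m k : 'X_{1..n}) (p : R) :
  ('X_[m] * p)@_k = if (m <= k)%MM then p@_(k - m) else 0.
Proof.
rewrite mulrC; case: ifP => mk; first by rewrite -{1}(submK mk) addmC mcoeffMX.
rewrite [p]mpolyE mulr_suml raddf_sum /= big1 // => m' _.
rewrite -scalerAl -mpolyXD mcoeffZ mcoeffX; case: eqP => [e|]; last by rewrite mulr0.
by rewrite -e lem_addl in mk.
Qed.

(** Division by a monomial, which drops the terms that are not multiples of it. *)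
Definition mdiv (m : 'X_{1..n}) (p : R) : R :=
  \sum_(k <- msupp p | (m <= k)%MM) p@_k *: 'X_[k - m].

Lemma mcoeff_mdiv m p k : (mdiv m p)@_k = p@_(k + m).
Proof.
rewrite /mdiv raddf_sum /=.
have eqk (k' : 'X_{1..n}) : (m <= k')%MM -> ((k' - m)%MM == k) = (k' == (k + m)%MM).
  by move=> mk'; apply/eqP/eqP => [<-|->]; rewrite ?addmK ?submK.
under eq_bigr => k' mk' do rewrite mcoeffZ mcoeffX eqk // mulr_natr mulrb.
rewrite -big_mkcondr /=.
have [kp|kp] := boolP ((k + m)%MM \in msupp p).
  rewrite big_mkcond (bigD1_seq _ kp) ?msupp_uniq //= lem_addl eqxx /= big1_seq ?addr0 //.
  by move=> k' /andP[kN _]; rewrite (negbTE kN) andbF.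
rewrite big1_seq; first by apply/esym/eqP; rewrite mcoeff_eq0.
by move=> k' /andP[/andP[_ /eqP ->]]; rewrite (negbTE kp).
Qed.

Lemma mdiv_is_additive m : zmod_morphism (mdiv m).
Proof.
by move=> p q; apply/mpolyP => k; rewrite mcoeffB !mcoeff_mdiv mcoeffB.
Qed.

HB.instance Definition _ m :=
  GRing.isZmodMorphism.Build R R (mdiv m) (mdiv_is_additive m).

Lemma mdivK m p : mdiv m ('X_[m] * p) = p.
Proof.
by apply/mpolyP => k; rewrite mcoeff_mdiv mcoeff_XM lem_addl addmK.
Qed.

Lemma mdivXM u v p : u != v -> mdiv U_(v) ('X_u * p) = 'X_u * mdiv U_(v) p.
Proof.
move=> uv; apply/mpolyP => m; rewrite mcoeff_mdiv !mcoeff_XM mcoeff_mdiv.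
rewrite !lep1mP mnmDE mnm1E (eq_sym v u) (negbTE uv) addn0.
case: ifP => // mu; congr (p@_ _); apply/mnmP => w; rewrite !(mnmDE, mnmBE) !mnm1E.
case: (u =P w) => [<-|_]; last by rewrite !subn0.
by rewrite (eq_sym v u) (negbTE uv) !addn0.
Qed.

Lemma divides_variables_free :
  divides_variables (fun v => mdiv U_(v) : {additive R^o -> R^o}).
Proof.
move=> v; split=> [y|u y uv]; [exact: mdivK | exact: mdivXM].
Qed.

Lemma divides_variables_rV g :
  divides_variables (fun v => map_mx (mdiv U_(v)) : {additive 'rV[R]_g -> 'rV[R]_g}).
Proof.
move=> v; split=> [y|u y uv]; apply/rowP => i; rewrite !mxE.
  exact: mdivK.
exact: mdivXM.
Qed.

Import monalg.

(** The free module on an arbitrary type, with coefficientwise division. *)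
Definition free_divX (I : choiceType) v (g : monalg.malg I R) : monalg.malg I R :=
  \sum_(k <- finmap.enum_fset (monalg.msupp g)) monalg.mkmalgU k (mdiv U_(v) (monalg.mcoeff k g)).

Lemma mcoeff_free_divX (I : choiceType) v (g : monalg.malg I R) k :
  monalg.mcoeff k (free_divX v g) = mdiv U_(v) (monalg.mcoeff k g).
Proof.
rewrite /free_divX raddf_sum /=.
under eq_bigr => i _ do rewrite monalg.mcoeffU mulrb eq_sym.
have [kg|kg] := boolP (k \in finmap.enum_fset (monalg.msupp g)).
  rewrite (bigD1_seq _ kg) ?finmap.fset_uniq //= eqxx big1 ?addr0 // => i ik.
  by rewrite eq_sym (negbTE ik).
rewrite big1_seq => [|i /andP[_ ig]]; last by case: eqP => // ki; rewrite ki ig in kg.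
have /eqP -> : monalg.mcoeff k g == 0 by rewrite monalg.mcoeff_eq0.
by rewrite raddf0.
Qed.

Lemma free_divX_is_additive (I : choiceType) v :
  zmod_morphism (@free_divX I v).
Proof.
move=> p q; apply/monalg.malgP => k.
by rewrite monalg.mcoeffB !mcoeff_free_divX monalg.mcoeffB raddfB.
Qed.

Definition free_divX_additive (I : choiceType) v :
    {additive monalg.malg I R -> monalg.malg I R} :=
  HB.pack (@free_divX I v)
    (GRing.isZmodMorphism.Build _ _ _ (@free_divX_is_additive I v)).

Lemma divides_variables_malg (I : choiceType) :
  divides_variables (L := monalg.malg I R : lmodType R) (free_divX_additive I).
Proof.
move=> v; split=> [y|u y uv]; apply/monalg.malgP => k;
  rewrite mcoeff_free_divX !monalg.mcoeffZ ?mcoeff_free_divX.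
  exact: mdivK.
exact: mdivXM.
Qed.

End Divisions.

Section Projectives.
Variables (K : fieldType) (n : nat).
Local Notation R := {mpoly K[n]}.
Implicit Types (u v : 'I_n) (A B : {set 'I_n}).

Definition rV_comb (L : lmodType R) g (a : 'I_g -> L) (x : 'rV[R]_g) : L :=
  \sum_i x 0 i *: a i.

Lemma rV_comb_is_linear (L : lmodType R) g (a : 'I_g -> L) : linear (rV_comb a).
Proof.
move=> t x y; rewrite /rV_comb scaler_sumr -big_split; apply: eq_bigr => i _.
by rewrite !mxE scalerDl scalerA.
Qed.

HB.instance Definition _ (L : lmodType R) g (a : 'I_g -> L) :=
  GRing.isLinear.Build R 'rV[R]_g L _ (rV_comb a) (rV_comb_is_linear a).

Lemma rV_comb_delta (L : lmodType R) g (f : {linear 'rV[R]_g -> L}) x :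
  f x = rV_comb (fun i => f (delta_mx 0 i)) x.
Proof. by rewrite [x in LHS]row_sum_delta linear_sum; apply: eq_bigr => i _; rewrite linearZ. Qed.

Lemma projective_rV g : projective ('rV[R]_g : lmodType R).
Proof.
move=> A B f h fsurj.
pose a i := sval (constructive_indefinite_description _ (fsurj (h (delta_mx 0 i)))).
exists (rV_comb a) => x; rewrite linear_sum [RHS]rV_comb_delta; apply: eq_bigr => i _.
by rewrite linearZ /a; case: constructive_indefinite_description => /= y ->.
Qed.

Section Cover.
Import monalg.
Variable P : lmodType R.

Definition malg_eval (g : monalg.malg P R) : P :=
  \sum_(k <- finmap.enum_fset (monalg.msupp g)) monalg.mcoeff k g *: k.

Lemma malg_evalEw (D : finmap.finset_of (Phant P)) g : finmap.fsubset (monalg.msupp g) D ->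
  malg_eval g = \sum_(k <- finmap.enum_fset D) monalg.mcoeff k g *: k.
Proof.
move=> gD; rewrite /malg_eval (finmap.big_fset_incl _ gD) //= => k _ kg.
by rewrite monalg.mcoeff_outdom ?scale0r.
Qed.

Lemma malg_eval_is_linear : linear malg_eval.
Proof.
move=> a x y.
pose D := finmap.fsetU (monalg.msupp (a *: x + y)) (finmap.fsetU (monalg.msupp x) (monalg.msupp y)).
rewrite !(@malg_evalEw D) ?scaler_sumr -?big_split; first last.
- by rewrite /D finmap.fsubsetUl.
- by rewrite /D (finmap.fsubset_trans _ (finmap.fsubsetUr _ _)) // finmap.fsubsetUl.
- by rewrite /D (finmap.fsubset_trans _ (finmap.fsubsetUr _ _)) // finmap.fsubsetUr.
by apply: eq_bigr => k _; rewrite monalg.mcoeffD monalg.mcoeffZ scalerDl scalerA.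
Qed.

Definition malg_eval_linear : {linear monalg.malg P R -> P} :=
  HB.pack malg_eval (GRing.isLinear.Build R _ P *:%R malg_eval malg_eval_is_linear).

Lemma malg_evalU k : malg_eval (monalg.mkmalgU k 1) = k.
Proof.
rewrite (@malg_evalEw (finmap.fset1 k)); last exact: monalg.msuppU_le.
by rewrite finmap.big_seq_fset1 monalg.mcoeffU eqxx scale1r.
Qed.

(** A projective module is a direct summand of the free module on its own
    elements, and a section carries the division operators over. *)
Lemma projective_divides : projective P ->
  exists T : 'I_n -> {additive P -> P}, divides_variables T.
Proof.
move=> /(_ _ _ malg_eval_linear (@idfun P)) [k|s sK].
  by exists (monalg.mkmalgU k 1); exact: malg_evalU.
exists (fun v => malg_eval_linear \o (free_divX_additive K P v \o s)).
have Tdiv := @divides_variables_malg K n P.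
move=> v; have [/= TK TX] := Tdiv v; split=> [y|u y uv] /=; rewrite linearZ /=.
  by rewrite TK; apply: sK.
by rewrite TX // -[LHS]/(malg_eval_linear _) linearZ.
Qed.
End Cover.
End Projectives.

(** * Dimension shifting, projective dimension and regular sequences *)

Section DimensionShift.
Variables (K : fieldType) (n : nat).
Local Notation R := {mpoly K[n]}.
Implicit Types (u v : 'I_n) (A B : {set 'I_n}).
Local Notation anything := (fun=> True).

Lemma koszul_exact_iff (L : lmodType R) i (P P' Q Q' : L -> Prop) :
  (forall x, Q x <-> Q' x) -> koszul_exact i P P' Q -> koszul_exact i P P' Q'.
Proof.
move=> QQ ex c cP cQ; have [||c' [c'P c'Q]] := ex c => //.
  by move=> A cA; apply/QQ; apply: cQ.
by exists c'; split=> // A cA; apply/QQ; apply: c'Q.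
Qed.

Lemma koszul_exact_weaken (L : lmodType R) i (P1 P2 P1' P2' Q : L -> Prop) :
  (forall x, P2 x -> P1 x) -> (forall x, P1' x -> P2' x) ->
  koszul_exact i P1 P1' Q -> koszul_exact i P2 P2' Q.
Proof.
move=> PP PP' ex c cP cQ; have [|c' [c'P c'Q]] := ex c _ cQ.
  by move=> A cA; apply/PP; apply: cP.
by exists c'; split=> // A cA; apply/PP'; apply: c'P.
Qed.

(** The value [y0] is used at the sets of cardinality other than [i]. *)
Lemma chain_lift (T : Type) (i : nat) (W : {set 'I_n} -> T -> Prop) (y0 : T) :
  (forall A, #|A| = i -> exists y, W A y) ->
  exists c : {set 'I_n} -> T, forall A, #|A| = i -> W A (c A).
Proof.
move=> ex; apply: (@fin_all_exists _ (fun=> T) (fun A y => #|A| = i -> W A y)) => A.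
have [cA|cA] := eqVneq #|A| i; first by have [y Wy] := ex A cA; exists y.
by exists y0 => e; rewrite e eqxx in cA.
Qed.

Section Shift.
Variables (L1 L0 : lmodType R) (delta : {linear L1 -> L0}).
Let image x := exists y, delta y = x.
Let kernel x := delta x = 0.

(** The connecting homomorphism from the homology of [L0 / image] in degree
    [i + 1] to that of [image], which is [L1 / kernel], in degree [i]: it is
    injective because [L0] is acyclic. *)
Lemma koszul_exact_cokernel i (P1 : L1 -> Prop) (P0 P0' : L0 -> Prop) :
  koszul_exact i.+1 anything anything (fun x : L0 => x = 0) ->
  (forall c A, (forall B, #|B| = i.+1 -> P0 (c B)) -> #|A| = i -> P0' (kdiff c A)) ->
  (forall x, P0' x -> image x -> exists2 y, P1 y & delta y = x) ->
  koszul_exact i P1 anything kernel -> koszul_exact i.+1 P0 anything image.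
Proof.
move=> acyc P0d lift ex c cP cI.
have [|b bE] := @chain_lift L1 i (fun A y => P1 y /\ delta y = kdiff c A) 0.
  move=> A cA; have [|y Py yE] := lift _ (P0d c A cP cA); last by exists y.
  by apply: cI; rewrite cA.
have [|A cA|b' [_ b'E]] := ex b; first by move=> A /bE[].
  rewrite /kernel kdiff_linear -[RHS](kdiff_kdiff c A); apply: eq_kdiff => B cB.
  by rewrite (bE B _).2 // cB cA.
have [//|A cA|c' [_ c'E]] := acyc (fun A => c A - delta (b' A)).
  case: cA => cA; rewrite kdiffB -kdiff_linear -(bE A cA).2 -linearB.
  exact: b'E.
exists c'; split=> // A cA; exists (b' A).
by apply/eqP; rewrite eq_sym -subr_eq0 addrAC; apply/eqP/c'E.
Qed.

(** The same homomorphism is onto as soon as the cycles of [image] bound in [L0].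
    In degree [i = 0] this is where minimality of a resolution enters. *)
Lemma koszul_exact_kernel i (P1 : L1 -> Prop) (P0 : L0 -> Prop) :
  (forall c, (forall A, #|A| = i -> P1 (c A)) ->
     (forall A, #|A|.+1 = i -> kdiff (fun B => delta (c B)) A = 0) ->
     exists b, (forall A, #|A| = i.+1 -> P0 (b A)) /\
               (forall A, #|A| = i -> delta (c A) = kdiff b A)) ->
  koszul_exact i.+1 P0 anything image -> koszul_exact i P1 anything kernel.
Proof.
move=> bound ex c cP cK.
have [||b [bP bE]] := bound c => //.
  by move=> A cA; rewrite -kdiff_linear; apply: cK.
have [//|A [cA]|b' [_ b'E]] := ex b.
  by exists (c A); rewrite bE.
have [b'' b''E] := @chain_lift L1 i.+1 (fun A y => delta y = b A - kdiff b' A) 0 b'E.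
exists b''; split=> // A cA; rewrite /kernel linearB kdiff_linear bE //.
rewrite [X in _ - X](_ : _ = kdiff (fun B => b B - kdiff b' B) A).
  by rewrite kdiffB kdiff_kdiff subr0 subrr.
by apply: eq_kdiff => B cB; apply: b''E; rewrite cB cA.
Qed.

End Shift.

(** As [eps] is onto, [M] is [L] modulo the kernel of [eps], and chains lift. *)
Lemma koszul_exact_onto (L M : lmodType R) (eps : {linear L -> M}) i
    (P : L -> Prop) (PM : M -> Prop) :
  (forall x, exists y, eps y = x) -> (forall x, PM x -> exists2 y, P y & eps y = x) ->
  koszul_exact i P anything (fun x => eps x = 0) ->
  koszul_exact i PM anything (fun x : M => x = 0).
Proof.
move=> onto lift ex c cP cyc.
have [|b bE] := @chain_lift L i (fun A y => P y /\ eps y = c A) 0.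
  by move=> A cA; have [y Py yE] := lift _ (cP A cA); exists y.
have [|A cA|b' [_ b'E]] := ex b; first by move=> A /bE[].
  rewrite kdiff_linear -[RHS](cyc A cA); apply: eq_kdiff => B cB.
  by rewrite (bE B _).2 // cB cA.
exists (fun A => eps (b' A)); split=> // A cA.
by rewrite -kdiff_linear -(bE A cA).2 -linearB; apply: b'E.
Qed.

Lemma koszul_exact_lift (L M : lmodType R) (eps : {linear L -> M}) i
    (P : L -> Prop) (PM : M -> Prop) :
  (forall x, exists y, eps y = x) -> (forall x, P x -> PM (eps x)) ->
  koszul_exact i PM anything (fun x : M => x = 0) ->
  koszul_exact i P anything (fun x => eps x = 0).
Proof.
move=> onto epsP ex c cP cyc.
have [|A cA|b' [_ b'E]] := ex (fun A => eps (c A)); first by move=> A /cP/epsP.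
  by rewrite -kdiff_linear cyc.
have [|b bE] := @chain_lift L i.+1 (fun A y => eps y = b' A) 0.
  by move=> A _; apply: onto.
exists b; split=> // A cA; rewrite linearB kdiff_linear -[RHS](b'E A cA); congr (_ - _).
by apply: eq_kdiff => B cB; apply: bE; rewrite cB cA.
Qed.

(** Shifting dimensions along the resolution moves degree [i] at [M] to degree
    [i - s] at the cokernel of [d s], which is zero for [s > l]. *)
Lemma koszul_exact_pdim (M : lmodType R) l i :
  has_projective_resolution M l -> (l < i)%N ->
  koszul_exact i anything anything (fun x : M => x = 0).
Proof.
case=> P [d [eps [proj Pzero onto ex0 exS]]] li.
suff V : forall i s, (l < s + i)%N ->
    koszul_exact i anything anything (fun x : P s => exists y, d s y = x).
  apply: (koszul_exact_onto (P := anything) onto) => [x _|].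
    by have [y yE] := onto x; exists y.
  by apply: koszul_exact_iff (V i 0%N li) => x; split=> /ex0.
elim=> [|j IH] s lsj.
  move=> c _ _; exists (fun=> 0); split=> // A _; exists 0.
  by rewrite addn0 in lsj; rewrite [RHS](Pzero _ lsj) [LHS](Pzero _ lsj).
have [T Tdiv] := projective_divides (proj s).
apply: (@koszul_exact_cokernel _ _ (d s) j anything anything anything) => //.
- exact: koszul_acyclic Tdiv _.
- by move=> x _ [y yE]; exists y.
apply: koszul_exact_iff (IH s.+1 _); last by rewrite addSnnS.
by move=> x; split=> /exS.
Qed.

End DimensionShift.

Section RegularSequences.
Variables (K : fieldType) (n : nat) (M : lmodType {mpoly K[n]}).
Local Notation R := {mpoly K[n]}.
Implicit Types (fs : seq R) (A B : {set 'I_n}).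

Lemma seq_smulP fs (m : M) :
  seq_smul fs m <-> exists v : nat -> M, m = \sum_(0 <= i < size fs) fs`_i *: v i.
Proof.
split=> [[v ->]|[v ->]]; last by exists v; rewrite big_mkord.
exists (fun i => if insub i is Some j then v j else 0).
by rewrite big_mkord; apply: eq_bigr => i _; rewrite valK.
Qed.

Lemma seq_smul_submod fs : is_submodule (seq_smul (M := M) fs).
Proof.
split.
- by exists (fun=> 0); rewrite big1 // => i _; rewrite scaler0.
- move=> x y [v ->] [w ->]; exists (fun i => v i + w i).
  by rewrite -big_split; apply: eq_bigr => i _; rewrite scalerDr.
move=> a x [v ->]; exists (fun i => a *: v i).
by rewrite scaler_sumr; apply: eq_bigr => i _; rewrite !scalerA mulrC.
Qed.

Lemma seq_smul_rcons fs f (m : M) :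
  seq_smul (rcons fs f) m <-> exists z w, seq_smul fs z /\ m = z + f *: w.
Proof.
split=> [/seq_smulP[v ->]|[z [w [/seq_smulP[v ->] ->]]]].
  exists (\sum_(0 <= i < size fs) fs`_i *: v i), (v (size fs)); split.
    by apply/seq_smulP; exists v.
  rewrite size_rcons big_nat_recr //= nth_rcons ltnn eqxx; congr (_ + _).
  by apply: eq_big_nat => i /andP[_ ifs]; rewrite nth_rcons ifs.
apply/seq_smulP; exists (fun i => if (i < size fs)%N then v i else w).
rewrite size_rcons big_nat_recr //= nth_rcons ltnn eqxx; congr (_ + _).
by apply: eq_big_nat => i /andP[_ ifs]; rewrite nth_rcons ifs.
Qed.

Lemma seq_smul_nil (m : M) : seq_smul [::] m <-> m = 0.
Proof.
by split=> [[v ->]|->]; [rewrite big_ord0 | exists (fun=> 0); rewrite big_ord0].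
Qed.

(** Each regular element [f] of the irrelevant ideal lowers the length of the
    nonzero part of Koszul homology by one: as [f] acts as zero, the homology
    of [M] in degree [j] embeds into that of [M / f M] in degree [j + 1]. *)
Lemma koszul_exact_regular fs j :
  (forall f, f \in fs -> irrelevant_ideal f) -> regular_sequence M fs ->
  (n < j + size fs)%N -> koszul_exact j (fun=> True) (fun=> True) (fun x : M => x = 0).
Proof.
move=> fs0 [reg _] nj.
suff V : forall u i j, (i + u = size fs)%N -> (n < j + u)%N ->
    koszul_exact j (fun=> True) (fun=> True) (seq_smul (M := M) (take i fs)).
  by apply: koszul_exact_iff (V _ 0%N j erefl nj) => x; rewrite take0; apply: seq_smul_nil.
elim=> [|u IH] i {nj}j iu nj.
  move=> c _ _; exists (fun=> 0); split=> // A cA.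
  by have := max_card (mem A); rewrite card_ord cA leqNgt -[j]addn0 nj.
move=> c _ cyc; have Qmod := seq_smul_submod (take i fs).
have ifs : (i < size fs)%N by rewrite -iu addnS ltnS leq_addr.
have f0 : irrelevant_ideal fs`_i by apply: fs0; rewrite mem_nth.
have [b bE] := irrelevant_boundary Qmod f0 cyc.
have takeS : take i.+1 fs = rcons (take i fs) fs`_i by rewrite (take_nth 0).
have [||//|A [cA]|b' [_ b'E]] := IH i.+1 j.+1 _ _ b.
- by rewrite addSnnS.
- by rewrite addSnnS.
- rewrite takeS; apply/seq_smul_rcons.
  exists (- (fs`_i *: c A - kdiff b A)), (c A); split; last by rewrite opprB subrK.
  by rewrite -sub0r; apply: submodB => //; [case: Qmod|apply: bE].
have [|w wE] := @chain_lift n M j.+1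
   (fun A y => seq_smul (take i fs) (b A - kdiff b' A - fs`_i *: y)) 0.
  move=> A cA; have := b'E A cA; rewrite takeS => /seq_smul_rcons[z [y [Qz ->]]].
  by exists y; rewrite addrK.
exists w; split=> // A cA; apply: reg => //.
have -> : fs`_i *: (c A - kdiff w A) =
   (fs`_i *: c A - kdiff b A) + kdiff (fun B => b B - kdiff b' B - fs`_i *: w B) A.
  by rewrite !kdiffB kdiff_kdiff kdiffZ subr0 addrA subrK scalerBr.
case: (Qmod) => _ QD _; apply: QD; first exact: bE.
by apply: submod_kdiff => // B cB; apply: wE; rewrite cB cA.
Qed.

End RegularSequences.

(** * Graded pieces of polynomials and rows *)

Section Graded.
Variables (K : fieldType) (n : nat).
Local Notation R := {mpoly K[n]}.
Implicit Types (u v : 'I_n) (A B : {set 'I_n}) (p : R) (z q : int).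

Lemma is_homogeneousP z p :
  is_homogeneous z p <-> forall m, p@_m != 0 -> z = (mdeg m)%:Z.
Proof.
case: z => [d|d] /=.
  split=> [/dhomogP hp m|hp]; first by rewrite -mcoeff_msupp => /hp <-.
  by apply/dhomogP => m; rewrite mcoeff_msupp => /hp [->].
split=> [->|hp]; first by move=> m; rewrite mcoeff0 eqxx.
apply/mpolyP => m; rewrite mcoeff0; apply/eqP/negPn/negP => /hp.
by [].
Qed.

(** Indexed by integers since the generators of a graded free module may sit in
    any degree. *)
Definition hcomp z p : R := if z is Posz d then pihomog mdeg d p else 0.

Lemma mcoeff_hcomp z p m : (hcomp z p)@_m = if z == (mdeg m)%:Z then p@_m else 0.
Proof.
case: z => [d|d] /=; last by rewrite mcoeff0.
rewrite pihomogE raddf_sum /=.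
under eq_bigr => k _ do rewrite mcoeffZ mcoeffX mulr_natr mulrb.
rewrite eqz_nat -big_mkcondr /=; case: eqP => [dm|dm]; last first.
  by rewrite big_pred0 // => k; apply/andP => -[/eqP dk /eqP km]; rewrite -dk km in dm.
have [mp|mp] := boolP (m \in msupp p); last first.
  rewrite big1_seq; first by apply/esym/eqP; rewrite mcoeff_eq0.
  by move=> k /andP[/andP[_ /eqP ->]]; rewrite (negbTE mp).
rewrite big_mkcond (bigD1_seq _ mp) ?msupp_uniq //= eqxx dm eqxx big1 ?addr0 // => k km.
by rewrite (negbTE km) andbF.
Qed.

Lemma hcomp_is_linear z : linear (hcomp z).
Proof.
move=> a p p'; apply/mpolyP => m; rewrite !(mcoeff_hcomp, mcoeffD, mcoeffZ).
by case: ifP => // _; rewrite mulr0 addr0.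
Qed.
HB.instance Definition _ z := GRing.isLinear.Build K R R _ (hcomp z) (hcomp_is_linear z).

Lemma hcompP z p : is_homogeneous z (hcomp z p).
Proof. by apply/is_homogeneousP => m; rewrite mcoeff_hcomp; case: (z =P _) => //; rewrite eqxx. Qed.

Lemma hcomp_id z p : is_homogeneous z p -> hcomp z p = p.
Proof.
move/is_homogeneousP => hp; apply/mpolyP => m; rewrite mcoeff_hcomp.
by case: eqP => // zm; apply/esym/eqP/negPn/negP => /hp.
Qed.

Lemma hcompM e z a p : is_homogeneous e a -> hcomp z (a * p) = a * hcomp (z - e) p.
Proof.
move/is_homogeneousP => ha; apply/mpolyP => m; rewrite mcoeff_hcomp !mcoeffM.
have term (k1 k2 : 'X_{1..n}) : m = (k1 + k2)%MM ->
    a@_k1 * (hcomp (z - e) p)@_k2 = if z == (mdeg m)%:Z then a@_k1 * p@_k2 else 0.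
  move=> ->; rewrite mcoeff_hcomp; have [->|/ha ->] := eqVneq a@_k1 0.
    by rewrite !mul0r if_same.
  by rewrite mdegD PoszD subr_eq addrC; case: ifP => // _; rewrite mulr0.
under [RHS]eq_bigr => k /eqP mk do rewrite (term _ _ mk).
by case: ifP => // _; rewrite big1.
Qed.

Lemma is_homogeneousM e z a p :
  is_homogeneous e a -> is_homogeneous z p -> is_homogeneous (e + z) (a * p).
Proof.
move=> ha hp; rewrite -(hcomp_id hp) -[z in hcomp z](addrK e) [z + e]addrC.
by rewrite -(hcompM _ _ ha); apply: hcompP.
Qed.

Lemma is_homogeneousX m : is_homogeneous (mdeg m)%:Z ('X_[m] : R).
Proof. by rewrite /is_homogeneous dhomogX. Qed.

Lemma is_homogeneous_var v : is_homogeneous 1 ('X_v : R).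
Proof. by rewrite -[1]/((1%N)%:Z) -(mdeg1 v); apply: is_homogeneousX. Qed.

Lemma is_homogeneous0 z : is_homogeneous z (0 : R).
Proof. by apply/is_homogeneousP => m; rewrite mcoeff0 eqxx. Qed.

Lemma is_homogeneousD z p p' :
  is_homogeneous z p -> is_homogeneous z p' -> is_homogeneous z (p + p').
Proof. by move=> hp hp'; rewrite -(hcomp_id hp) -(hcomp_id hp') -linearD; apply: hcompP. Qed.

Lemma is_homogeneousB z p p' :
  is_homogeneous z p -> is_homogeneous z p' -> is_homogeneous z (p - p').
Proof. by move=> hp hp'; rewrite -(hcomp_id hp) -(hcomp_id hp') -linearB; apply: hcompP. Qed.

Lemma is_homogeneous_sum (I : finType) (P : pred I) z (f : I -> R) :
  (forall i, P i -> is_homogeneous z (f i)) -> is_homogeneous z (\sum_(i | P i) f i).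
Proof.
by move=> hf; apply: big_ind => //; [exact: is_homogeneous0|exact: is_homogeneousD].
Qed.

Lemma is_homogeneous_ksign v A : is_homogeneous 1 (ksign K v A * 'X_v).
Proof.
rewrite -[1]add0r; apply: is_homogeneousM; last exact: is_homogeneous_var.
rewrite /ksign -signr_odd; case: odd; rewrite ?expr0 ?expr1 /=; last exact: dhomog1.
by rewrite rpredN; exact: dhomog1.
Qed.

Section Rows.
Variables (g : nat) (deg : 'I_g -> int).
Implicit Types x y : 'rV[R]_g.

(** The piece of degree [q] of the free module whose [a]-th basis element has
    degree [deg a]. *)
Definition row_piece q x : Prop := forall a, is_homogeneous (q - deg a) (x 0 a).
Definition row_comp q x : 'rV[R]_g := \row_a hcomp (q - deg a) (x 0 a).

Lemma row_comp_is_additive q : zmod_morphism (row_comp q).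
Proof. by move=> x y; apply/rowP => a; rewrite !mxE linearB. Qed.
HB.instance Definition _ q :=
  GRing.isZmodMorphism.Build 'rV[R]_g 'rV[R]_g (row_comp q) (row_comp_is_additive q).

Lemma row_compP q x : row_piece q (row_comp q x).
Proof. by move=> a; rewrite mxE; apply: hcompP. Qed.

Lemma row_comp_id q x : row_piece q x -> row_comp q x = x.
Proof. by move=> hx; apply/rowP => a; rewrite mxE hcomp_id. Qed.

Lemma row_compZ e q a x : is_homogeneous e a -> row_comp q (a *: x) = a *: row_comp (q - e) x.
Proof. by move=> ha; apply/rowP => b; rewrite !mxE (hcompM _ _ ha) addrAC. Qed.

Lemma row_comp_kdiff q (c : {set 'I_n} -> 'rV[R]_g) A :
  row_comp q (kdiff c A) = kdiff (fun B => row_comp (q - 1) (c B)) A.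
Proof.
rewrite raddf_sum; apply: eq_bigr => v _.
exact: row_compZ (is_homogeneous_ksign v A).
Qed.

Lemma row_piece_kdiff q (c : {set 'I_n} -> 'rV[R]_g) A :
  (forall B, #|B| = #|A|.+1 -> row_piece q (c B)) -> row_piece (q + 1) (kdiff c A).
Proof.
move=> hc; rewrite (eq_kdiff (c' := fun B => row_comp (q + 1 - 1) (c B))).
  by rewrite -row_comp_kdiff; apply: row_compP.
by move=> B cB; rewrite addrK row_comp_id //; apply: hc.
Qed.

Lemma row_piece_delta a : row_piece (deg a) (delta_mx 0 a).
Proof.
move=> b; rewrite mxE eqxx /= eq_sym; case: eqP => [->|_]; last exact: is_homogeneous0.
by rewrite subrr; exact: dhomog1.
Qed.

Lemma row_comp_sum x (s : seq int) : uniq s ->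
  (forall a m, (x 0 a)@_m != 0 -> deg a + (mdeg m)%:Z \in s) ->
  x = \sum_(q <- s) row_comp q x.
Proof.
move=> us sx; apply/rowP => a; rewrite summxE; apply/mpolyP => m; rewrite raddf_sum /=.
have e q : (q - deg a == (mdeg m)%:Z) = (q == deg a + (mdeg m)%:Z).
  by rewrite subr_eq addrC.
under eq_bigr => q _ do rewrite mxE mcoeff_hcomp e.
have [->|xm] := eqVneq (x 0 a)@_m 0; first by rewrite big1 // => q _; rewrite if_same.
rewrite -big_mkcond /= (eq_bigl (pred1 (deg a + (mdeg m)%:Z))) //.
by rewrite -big_filter filter_pred1_uniq ?sx // big_seq1.
Qed.

Lemma row_comp_exhaust x : exists s : seq int, x = \sum_(q <- s) row_comp q x.
Proof.
pose s := undup (flatten [seq [seq deg a + (mdeg m)%:Z | m <- msupp (x 0 a)] | a <- enum 'I_g]).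
exists s; apply: row_comp_sum; first exact: undup_uniq.
move=> a m xm; rewrite mem_undup; apply/flattenP.
exists [seq deg a + (mdeg m)%:Z | m <- msupp (x 0 a)].
  by apply/mapP; exists a => //; rewrite mem_enum.
by apply/mapP; exists m => //; rewrite mcoeff_msupp.
Qed.

Definition irrelevant_row x : Prop := forall a, irrelevant_ideal (x 0 a).

Lemma irrelevant_row_kdiff (c : {set 'I_n} -> 'rV[R]_g) A : irrelevant_row (kdiff c A).
Proof.
move=> a; rewrite /irrelevant_ideal /kdiff summxE raddf_sum big1 // => v _ /=.
rewrite mxE -mulrA mulrCA -[X in X * _]/('X_[U_(v)]) mcoeff_XM.
by rewrite lep1mP mnm0E.
Qed.

(** A cycle of rows is a boundary; in homological degree zero, where there is
    no cycle condition, the obstruction is the constant term. *)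
Lemma row_boundary i q (c : {set 'I_n} -> 'rV[R]_g) :
  (forall A, #|A| = i -> row_piece (q + 1) (c A)) ->
  (forall A, #|A|.+1 = i -> kdiff c A = 0) ->
  (i = 0%N -> irrelevant_row (c set0)) ->
  exists b, (forall A, #|A| = i.+1 -> row_piece q (b A)) /\
            (forall A, #|A| = i -> c A = kdiff b A).
Proof.
move=> cP cyc irr.
suff [b bE] : exists b, forall A, #|A| = i -> c A = kdiff b A.
  exists (fun B => row_comp q (b B)); split=> A cA; first exact: row_compP.
  by rewrite -[q](addrK 1) -row_comp_kdiff -bE // row_comp_id //; apply: cP.
case: i => [|i] in cP cyc irr *; last first.
  have [//|//|b [_ bE]] := koszul_acyclic (@divides_variables_rV K n g) (ltn0Sn i) (c := c).
  by exists b => A cA; apply/eqP; rewrite -subr_eq0; apply/eqP/bE.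
suff [b bE] : exists b, c set0 = kdiff b set0.
  by exists b => A /eqP; rewrite cards_eq0 => /eqP ->.
rewrite [c set0]row_sum_delta; apply: (big_ind (fun x => exists b, x = kdiff b set0)).
- exists (fun=> 0); rewrite (submod_kdiff (Q := fun x => x = 0)) //.
  by split=> [//|x y -> ->|a x ->]; rewrite ?addr0 ?scaler0.
- by move=> _ _ [b ->] [b' ->]; exists (fun B => b B + b' B); rewrite kdiffD.
move=> a _.
have [|//|b bE] := @irrelevant_boundary K n _ (fun x : 'rV[R]_g => x = 0) _ 0%N
  (fun=> delta_mx 0 a) _ (irr erefl a).
- by split=> [//|x y -> ->|t x ->]; rewrite ?addr0 ?scaler0.
by exists b; apply/eqP; rewrite -subr_eq0; apply/eqP/bE; rewrite cards0.
Qed.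

End Rows.

Lemma row_comp_mulmx g1 g0 (deg1 : 'I_g1 -> int) (deg0 : 'I_g0 -> int) (D : 'M[R]_(g1, g0)) q x :
  (forall a b, is_homogeneous (deg1 a - deg0 b) (D a b)) ->
  row_comp deg0 q (x *m D) = row_comp deg1 q x *m D.
Proof.
move=> hD; apply/rowP => b; rewrite !mxE raddf_sum; apply: eq_bigr => a _ /=.
by rewrite mulrC (hcompM _ _ (hD a b)) mxE mulrC opprB addrA subrK.
Qed.

Lemma row_piece_mulmx g1 g0 (deg1 : 'I_g1 -> int) (deg0 : 'I_g0 -> int) (D : 'M[R]_(g1, g0)) q x :
  (forall a b, is_homogeneous (deg1 a - deg0 b) (D a b)) ->
  row_piece deg1 q x -> row_piece deg0 q (x *m D).
Proof. by move=> hD hx; rewrite -(row_comp_id hx) -(row_comp_mulmx _ _ hD); apply: row_compP. Qed.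

End Graded.

(** * Koszul homology of a Stanley-Reisner ring and its minimal resolutions *)

Section GradedBettiKoszul.
Variables (K : fieldType) (X : finType) (D : {set {set X}}).
Local Notation n := #|X|.
Local Notation R := {mpoly K[n]}.
Implicit Types (A B : {set 'I_n}) (p : R) (z q : int).
Local Notation anything := (fun=> True).
Local Notation piD := (modquot_pi (@SR_ideal K X D)).

Lemma SR_pi_eq0 p : piD p = 0 <-> in_SR_ideal D p.
Proof.
rewrite -(linear0 piD) modquot_piP subr0.
by split=> /SR_idealP.
Qed.

Lemma face_monomial_homogeneous (A : {set X}) :
  is_homogeneous #|A|%:Z (face_monomial K A).
Proof.
rewrite /face_monomial -sum1_card /=; apply: (big_rec2 (fun d p => is_homogeneous d%:Z p)).
  exact: dhomog1.
move=> x d p _ hp; rewrite PoszD; apply: is_homogeneousM => //.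
exact: is_homogeneous_var.
Qed.

Lemma SR_ideal_hcomp z p : in_SR_ideal D p -> in_SR_ideal D (hcomp z p).
Proof.
case=> c ->; exists (fun G : {set X} => hcomp (z - #|G|%:Z) (c G)); rewrite raddf_sum /=.
by apply: eq_bigr => G _; rewrite mulrC (hcompM _ _ (face_monomial_homogeneous G)) mulrC.
Qed.

(** [q] is the internal degree minus the homological degree, the quantity whose
    maximum is the regularity. *)
Definition SR_exact i q : Prop :=
  koszul_exact (L := R^o) i (is_homogeneous q) anything (in_SR_ideal (X := X) D).

Lemma SR_exact_piece i q :
  SR_exact i q <-> koszul_exact i (SR_piece (D := D) q) anything (fun x : SR_module K D => x = 0).
Proof.
split=> ex.
  apply: (@koszul_exact_onto K n R^o _ piD i (is_homogeneous q)).
  - by move=> x; have [y ->] := modquot_pi_surj x; exists y.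
  - by move=> x [p hp ->]; exists p.
  by apply: koszul_exact_iff ex => p; apply: iff_sym; apply: SR_pi_eq0.
apply: (@koszul_exact_iff K n R^o _ _ _ (fun p => piD p = 0)); first exact: SR_pi_eq0.
apply: koszul_exact_lift ex.
- by move=> x; have [y ->] := modquot_pi_surj x; exists y.
- by move=> p hp; exists p.
Qed.

Section Resolution.
Variables (F : gfree K n) (eps : {linear 'rV[R]_(grank F 0) -> SR_module K D}).
Hypotheses
  (Fdeg0 : forall a, SR_piece (gdeg a) (eps (delta_mx 0 a)))
  (FdegS : forall i a b, is_homogeneous (gdeg a - gdeg b) (gdiff F i a b))
  (Fonto : forall m, exists v, eps v = m)
  (Fex0 : forall v, eps v = 0 <-> exists w, w *m gdiff F 0 = v)
  (FexS : forall i (v : 'rV_(grank F i.+1)),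
          v *m gdiff F i = 0 <-> exists w, w *m gdiff F i.+1 = v)
  (Fmin : forall i a b, irrelevant_ideal (gdiff F i a b)).

Let deg i : 'I_(grank F i) -> int := @gdeg K n F i.

(** [eps] is the augmentation to the quotient ring followed by a homogeneous
    column of polynomials. *)
Lemma eps_homogeneous : exists p : 'I_(grank F 0) -> R,
  (forall a, is_homogeneous (deg a) (p a)) /\
  (forall x, eps x = piD (\sum_a x 0 a * p a)).
Proof.
pose image a r := is_homogeneous (deg a) r /\ eps (delta_mx 0 a) = piD r.
have [p hp] : exists p : 'I_(grank F 0) -> R, forall a, image a (p a).
  apply: (@fin_all_exists _ (fun=> R) image) => a.
  by have [p hp e] := Fdeg0 a; exists p.
exists p; split=> [a|x]; first by have [] := hp a.
rewrite [x in LHS]row_sum_delta !linear_sum; apply: eq_bigr => a _.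
by rewrite linearZ (hp a).2 -linearZ.
Qed.

Lemma eps_piece q x : row_piece (@deg 0) q x -> SR_piece q (eps x).
Proof.
have [p [hp eE]] := eps_homogeneous => hx; exists (\sum_a x 0 a * p a); last exact: eE.
apply: is_homogeneous_sum => a _; rewrite -(subrK (deg a) q).
by apply: is_homogeneousM.
Qed.

Lemma eps_comp q x y : SR_piece q y -> eps x = y -> eps (row_comp (@deg 0) q x) = y.
Proof.
have [p [hp eE]] := eps_homogeneous => -[r hr ->]; rewrite !eE => /modquot_piP/SR_idealP H.
apply/modquot_piP/SR_idealP; rewrite -{1}(hcomp_id hr).
rewrite [X in X - _](_ : _ = hcomp q (\sum_a x 0 a * p a)).
  by rewrite -linearB; apply: SR_ideal_hcomp.
rewrite raddf_sum; apply: eq_bigr => a _.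
by rewrite /= mxE mulrC [in RHS]mulrC (hcompM _ _ (hp a)).
Qed.

(** Exactness for the [s]-th syzygy module, presented as a cokernel. *)
Definition cokernel_exact s i q : Prop :=
  koszul_exact i (row_piece (@deg s) q) anything (fun x => exists w, w *m gdiff F s = x).

Lemma cokernel_exact0 i q : SR_exact i q <-> cokernel_exact 0 i q.
Proof.
split=> [/SR_exact_piece ex|ex].
  apply: (koszul_exact_iff Fex0).
  by apply: koszul_exact_lift ex => // x; apply: eps_piece.
apply/SR_exact_piece; apply: (@koszul_exact_onto _ _ _ _ eps i (row_piece (@deg 0) q)) => //.
  move=> x qx; have [y yE] := Fonto x; exists (row_comp (@deg 0) q y); first exact: row_compP.
  exact: eps_comp.
by apply: koszul_exact_iff ex => x; split=> /Fex0.
Qed.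

Lemma irrelevant_row_mulmx s (w : 'rV[R]_(grank F s.+1)) : irrelevant_row (w *m gdiff F s).
Proof.
move=> a; rewrite /irrelevant_ideal mxE raddf_sum big1 // => b _ /=.
by rewrite rmorphM /= (Fmin b a) mulr0.
Qed.

(** The differential of an element of a minimal resolution has no constant
    terms, so it is a Koszul boundary even in degree zero. *)
Lemma cokernel_exactS s i q : cokernel_exact s i.+1 q -> cokernel_exact s.+1 i (q + 1).
Proof.
move=> ex; apply: (koszul_exact_iff (FexS (i := s))).
apply: (@koszul_exact_kernel _ _ _ _ (mulmxr (gdiff F s)) i _ (row_piece (@deg s) q))
  => //= c cP cyc.
apply: row_boundary => //.
  by move=> A cA; apply: (row_piece_mulmx (@FdegS s)); apply: cP.
by move=> _; apply: irrelevant_row_mulmx.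
Qed.

Lemma cokernel_exactP s i q : cokernel_exact s.+1 i (q + 1) -> cokernel_exact s i.+1 q.
Proof.
move=> ex.
apply: (@koszul_exact_cokernel _ _ _ _ (mulmxr (gdiff F s)) i (row_piece (@deg s.+1) (q + 1)) _
   (row_piece (@deg s) (q + 1))).
- exact: koszul_acyclic (@divides_variables_rV K n _) _.
- by move=> c A cP cA; apply: row_piece_kdiff => B cB; apply: cP; rewrite cB cA.
- move=> x qx [y /= yE]; exists (row_comp (@deg s.+1) (q + 1) y); first exact: row_compP.
  by rewrite /= -(row_comp_mulmx _ _ (@FdegS s)) yE row_comp_id.
by apply: koszul_exact_iff ex => x; split=> /FexS.
Qed.

Lemma cokernel_exact_iff s i q : SR_exact (s + i) q <-> cokernel_exact s i (q + s%:Z).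
Proof.
elim: s i => [|s IH] i; first by rewrite addr0; apply: cokernel_exact0.
rewrite addSnnS IH intS [1 + _]addrC addrA; split; first exact: cokernel_exactS.
exact: cokernel_exactP.
Qed.

(** The number of generators of degree [i + q] in the [i]-th step of a minimal
    resolution is the dimension of a graded piece of Koszul homology; here is
    the part of that equality which concerns vanishing. *)
Lemma minimal_generator_degree i q :
  SR_exact i q <-> forall a : 'I_(grank F i), gdeg a <> q + i%:Z.
Proof.
rewrite -[X in SR_exact X]addn0 cokernel_exact_iff; split=> [ex a da|nodeg].
  have [|//|c' [_ c'E]] := ex (fun=> delta_mx 0 a).
    by move=> A _; rewrite -da; apply: row_piece_delta.
  have [w wE] := c'E set0 (cards0 _).
  have := irrelevant_row_mulmx w a; rewrite wE /irrelevant_ideal !mxE mcoeffB.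
  rewrite (irrelevant_row_kdiff c' set0 a) subr0 !eqxx mcoeff1 eqxx => /eqP.
  by rewrite oner_eq0.
move=> c cP _.
have [|//|_|b [_ bE]] := @row_boundary K n _ (@deg i) 0 (q + i%:Z - 1) c.
- by move=> A cA; rewrite subrK; apply: cP.
- move=> a; apply/eqP; apply/negPn/negP => c0.
  have /is_homogeneousP/(_ _ c0) := cP set0 (cards0 _) a.
  by rewrite mdeg0 => /eqP; rewrite subr_eq0 => /eqP /esym; apply: nodeg.
exists b; split=> // A cA; exists 0.
by rewrite mul0mx bE // subrr.
Qed.

End Resolution.
End GradedBettiKoszul.

(** * Finite generation of syzygies *)

Section SubspaceOfPredicate.
Variables (K : fieldType) (V : vectType K) (Q : V -> Prop).
Hypotheses (Q0 : Q 0) (QD : forall k x y, Q x -> Q y -> Q (k *: x + y)).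

(** Enlarge a subspace on which [Q] holds until its dimension cannot grow. *)
Lemma vspace_of_pred : exists U : {vspace V}, forall v, v \in U <-> Q v.
Proof.
suff ext : forall k (U : {vspace V}), (\dim {:V} - \dim U <= k)%N ->
    (forall v, v \in U -> Q v) -> exists U : {vspace V}, forall v, v \in U <-> Q v.
  by apply: (ext _ 0%VS (leqnn _)) => v; rewrite memv0 => /eqP ->.
elim=> [|k IH] U dU UQ; (case: (classic (exists2 v, Q v & v \notin U)) => [[v Qv vU]|none];
  last by exists U => v; split=> [/UQ//|Qv]; apply/negPn/negP => vU; apply: none; exists v);
  have dUv : (\dim U < \dim (U + <[v]>)%VS)%N;
  try by rewrite (ltn_leqif (dimv_leqif_sup (addvSl _ _))) subv_add subvv -memvE.
  have := leq_trans dUv (dimvS (subvf _)).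
  by rewrite ltnNge -subn_eq0 -leqn0 dU.
apply: (IH (U + <[v]>)%VS) => [|x /memv_addP[u uU [w /vlineP[t ->] ->]]].
  by move: dUv dU; lia.
by rewrite addrC; apply: QD => //; apply: UQ.
Qed.
End SubspaceOfPredicate.

Section Existence.
Variables (K : fieldType) (n : nat).
Local Notation R := {mpoly K[n]}.
Implicit Types (A B : {set 'I_n}) (z q : int).
Local Notation anything := (fun=> True).

(** The smallest submodule that contains the rows [p.2] for [p] in [s], where
    [p.1] records a degree; the impredicative form makes it monotone in [s]. *)
Definition row_span g (s : seq (int * 'rV[R]_g)) (x : 'rV[R]_g) : Prop :=
  forall Q : 'rV[R]_g -> Prop, is_submodule Q -> (forall p, p \in s -> Q p.2) -> Q x.

Lemma row_span_submodule g (s : seq (int * 'rV[R]_g)) : is_submodule (row_span s).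
Proof.
split=> [Q [Q0 _ _] _ //|x y sx sy Q Qm Qs|a x sx Q Qm Qs].
  by case: (Qm) => _ QD _; apply: QD; [apply: sx|apply: sy].
by case: (Qm) => _ _ QZ; apply: QZ; apply: sx.
Qed.

Lemma row_span_sub g (s t : seq (int * 'rV[R]_g)) x :
  {subset s <= t} -> row_span s x -> row_span t x.
Proof. by move=> st sx Q Qm Qt; apply: sx => // p /st/Qt. Qed.

Section Stage.
Variables (g : nat) (deg : 'I_g -> int) (Z : 'rV[R]_g -> Prop) (bound : int).

Definition graded_submodule : Prop :=
  is_submodule Z /\ forall q x, Z x -> Z (row_comp deg q x).

Hypotheses (Zgr : graded_submodule) (Zirr : forall x, Z x -> irrelevant_row x)
  (Zex : forall i q, bound < q -> koszul_exact i (row_piece deg q) anything Z).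

(** A graded piece of a free module embeds in the functions on the pairs of a
    generator and a monomial of bounded degree, hence has finite dimension. *)
Lemma piece_finite q : exists s : seq (int * 'rV[R]_g),
  (forall p, p \in s -> row_piece deg p.1 p.2 /\ Z p.2) /\
  forall x, Z x -> row_piece deg q x -> row_span s x.
Proof.
have [Zmod Zcomp] := Zgr; have [Z0 ZD ZZ] := Zmod.
pose b := (\max_a `|q - deg a|%N).+1.
pose coords (x : 'rV[R]_g) : {ffun 'I_g * 'X_{1..n < b} -> K^o} :=
  [ffun p => (x 0 p.1)@_(val p.2)].
have coords_inj x y : row_piece deg q x -> row_piece deg q y -> coords x = coords y -> x = y.
  move=> qx qy /ffunP e; apply/rowP => a; apply/mpolyP => m.
  have [mb|mb] := ltnP (mdeg m) b.
    by have := e (a, BMultinom mb); rewrite !ffunE.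
  have out (w : 'rV[R]_g) : row_piece deg q w -> (w 0 a)@_m = 0.
    move=> qz; apply/eqP/negPn/negP => /((is_homogeneousP _ _).1 (qz a)) zm.
    move: mb; rewrite /b ltnNge => /negP; apply.
    by rewrite -[mdeg m]/`|(mdeg m)%:Z|%N -zm; apply: (leq_bigmax a).
  by rewrite !out.
pose Q w := exists x, [/\ Z x, row_piece deg q x & coords x = w].
have QC k x : row_piece deg q x -> row_piece deg q (k%:MP *: x).
  move=> qx; rewrite -(row_comp_id qx) -[q in row_comp _ q](subr0 q) -row_compZ ?subr0.
    exact: row_compP.
  rewrite /= dhomogE; apply/allP => m; rewrite msuppC; case: ifP => // _.
  by rewrite mem_seq1 => /eqP ->; rewrite /= mdeg0.
have QDr x y : row_piece deg q x -> row_piece deg q y -> row_piece deg q (x + y).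
  by move=> qx qy; rewrite -(row_comp_id qx) -(row_comp_id qy) -raddfD; apply: row_compP.
have [|k _ _ [x [Zx qx <-]] [y [Zy qy <-]]|U UQ] :=
  @vspace_of_pred K {ffun 'I_g * 'X_{1..n < b} -> K^o} Q.
- exists 0; split=> //; last by apply/ffunP => p; rewrite !ffunE mxE mcoeff0.
  by move=> a; rewrite mxE; apply: is_homogeneous0.
- exists (k%:MP *: x + y); split; [by apply: ZD => //; apply: ZZ|by apply: QDr => //; apply: QC|].
  by apply/ffunP => p; rewrite !ffunE !mxE mcoeffD mcoeffCM.
pose lifts (i : 'I_(\dim U)) y := [/\ Z y, row_piece deg q y & coords y = (vbasis U)`_i].
have [e eE] : exists e : 'I_(\dim U) -> 'rV[R]_g, forall i, lifts i (e i).
  apply: (@fin_all_exists _ (fun=> 'rV[R]_g) lifts) => i.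
  by apply/UQ; apply: vbasis_mem; rewrite mem_nth // size_tuple.
exists [seq (q, e i) | i <- enum 'I_(\dim U)]; split.
  by move=> _ /mapP[i _ ->]; have [] := eE i.
move=> x Zx qx; have /coord_vbasis xE : coords x \in U by apply/UQ; exists x.
have -> : x = \sum_i (coord (vbasis U) i (coords x))%:MP *: e i.
  apply: coords_inj => //.
    apply: (big_ind (row_piece deg q)); [|exact: QDr|].
      by move=> a; rewrite mxE; apply: is_homogeneous0.
    by move=> i _; apply: QC; have [] := eE i.
  rewrite [LHS]xE; apply/ffunP => p; rewrite sum_ffunE !ffunE summxE raddf_sum.
  by apply: eq_bigr => i _; have [_ _ <-] := eE i; rewrite /= !ffunE mxE mcoeffCM.
have [S0 SD SZ] := row_span_submodule [seq (q, e i) | i <- enum 'I_(\dim U)].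
apply: big_ind => // i _; apply: SZ => Q' _ Qs; apply: (Qs (q, e i)).
by apply/mapP; exists i; rewrite ?mem_enum.
Qed.

Lemma piece_below q (x : 'rV[R]_g) : (forall a, q < deg a) -> row_piece deg q x -> x = 0.
Proof.
move=> qdeg qx; apply/rowP => a; rewrite mxE; have := qx a.
have : q - deg a < 0 by rewrite subr_lt0.
by case: (q - deg a).
Qed.

Lemma pieces_finite (lo : int) (k : nat) : exists s : seq (int * 'rV[R]_g),
  (forall p, p \in s -> row_piece deg p.1 p.2 /\ Z p.2) /\
  forall i x, (i < k)%N -> Z x -> row_piece deg (lo + i%:Z) x -> row_span s x.
Proof.
elim: k => [|k [s [sP sE]]]; first by exists [::].
have [t [tP tE]] := piece_finite (lo + k%:Z).
exists (s ++ t); split=> [p|i x]; first by rewrite mem_cat => /orP[/sP|/tP].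
rewrite ltnS leq_eqVlt => /orP[/eqP -> Zx qx|ik Zx qx].
  by apply: row_span_sub (tE _ Zx qx) => p pt; rewrite mem_cat pt orbT.
by apply: row_span_sub (sE _ _ ik Zx qx) => p ps; rewrite mem_cat ps.
Qed.

(** Above [bound + 1] the vanishing of first Koszul homology says that [Z] is
    [m Z] in each degree, so finitely many degrees generate. *)
Lemma submodule_finite : exists s : seq (int * 'rV[R]_g),
  (forall p, p \in s -> row_piece deg p.1 p.2 /\ Z p.2) /\
  forall x, Z x -> row_span s x.
Proof.
have [Zmod Zcomp] := Zgr; have [Z0 ZD ZZ] := Zmod.
(* No basis element has degree below [lo], and the induction from one degree to
   the next works from [bound + 2] on, that is from [lo + k]. *)
pose lo : int := - (\sum_a `|deg a|%N)%:Z - `|bound|%:Z.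
have lodeg a : lo <= deg a.
  have : (`|deg a| <= \sum_a `|deg a|)%N by rewrite (bigD1 a) //= leq_addr.
  by rewrite /lo; move: (\sum_a _)%N => S; lia.
pose k := absz (bound + 2 - lo)%R.
have loB : lo <= bound by rewrite /lo; move: (\sum_a _)%N => S; lia.
have [s [sP sE]] := pieces_finite lo k.
exists s; split=> // x Zx.
have spanmod := row_span_submodule s; have [S0 SD SZ] := spanmod.
suff hom q y : Z y -> row_piece deg q y -> row_span s y.
  have [t ->] := row_comp_exhaust deg x; apply: big_ind => // q _.
  by apply: (hom q); [apply: Zcomp|apply: row_compP].
have [qlo|qlo] := ltP q lo.
  move=> _ qy; rewrite (@piece_below q y) // => a.
  exact: lt_le_trans qlo (lodeg a).
have [i ->] : exists i : nat, q = lo + i%:Z by exists (absz (q - lo)%R); lia.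
elim: i y {q qlo} => [|i IH] y Zy qy; first by apply: (sE 0%N) => //; rewrite /k; lia.
have [ik|ki] := ltnP i.+1 k; first exact: (sE i.+1).
pose q := lo + i%:Z; have qE : lo + i.+1%:Z = q + 1 by rewrite /q intS addrCA addrC.
have bq : bound < q by move: ki; rewrite /q /k; lia.
have [||_|b [bP bE]] := @row_boundary K n _ deg 0 q (fun=> y).
- by move=> A _; rewrite -qE.
- by [].
- exact: Zirr.
have [|A [/eqP cA]|b' [_ b'E]] := Zex bq (i := 1%N) (c := b).
- exact: bP.
- by move: cA; rewrite cards_eq0 => /eqP ->; rewrite -bE // cards0.
rewrite -(row_comp_id qy) qE.
rewrite (bE set0) ?cards0 //.
rewrite (_ : kdiff b set0 = kdiff (fun A => b A - kdiff b' A) set0); last first.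
  by rewrite kdiffB kdiff_kdiff subr0.
rewrite row_comp_kdiff addrK; apply: submod_kdiff => // A; rewrite cards0 => cA.
by apply: IH; [apply: Zcomp; apply: b'E|apply: row_compP].
Qed.

Definition generated N : Prop := exists (d : 'I_N -> int) (D : 'M[R]_(N, g)),
  (forall a b, is_homogeneous (d a - deg b) (D a b)) /\ forall x, Z x <-> exists w, w *m D = x.

Lemma submodule_generated : exists N, generated N.
Proof.
have [s [sP sE]] := submodule_finite.
pose nths := nth ((0 : int), (0 : 'rV[R]_g)) s.
exists (size s), (fun a => (nths a).1), (\matrix_(a < size s) (nths a).2).
have [Zmod _] := Zgr; have [Z0 ZD ZZ] := Zmod.
split=> [a b|x].
  by rewrite mxE; have [] := sP (nths a) (mem_nth _ (ltn_ord a)).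
split=> [/sE|[w <-]]; last first.
  rewrite mulmx_sum_row; apply: big_ind => // a _; apply: ZZ.
  by rewrite rowK; have [] := sP (nths a) (mem_nth _ (ltn_ord a)).
move=> span_x; apply: (span_x (fun y => exists w, w *m _ = y)).
  split; first by exists 0; rewrite mul0mx.
    by move=> _ _ [w <-] [w' <-]; exists (w + w'); rewrite mulmxDl.
  by move=> a _ [w <-]; exists (a *: w); rewrite scalemxAl.
move=> p ps; have ips : (index p s < size s)%N by rewrite index_mem.
exists (delta_mx 0 (Ordinal ips)).
by rewrite -rowE rowK /nths /= nth_index.
Qed.

(** Take the least number of generators: in a relation with a nonzero constant
    coefficient, the homogeneous component of the right degree has a unit as
    coefficient, and expresses one generator by the others. *)
Lemma irredundant_generators : exists N (d : 'I_N -> int) (D : 'M[R]_(N, g)),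
  [/\ forall a b, is_homogeneous (d a - deg b) (D a b),
      forall x, Z x <-> exists w, w *m D = x &
      forall w, w *m D = 0 -> irrelevant_row w].
Proof.
have [N0 genN0] := submodule_generated.
elim/ltn_ind: N0 genN0 => N IH [d [D [hD ZD]]].
case: (classic (forall w, w *m D = 0 -> irrelevant_row w)) => [irr|/not_all_ex_not[w]].
  by exists N, d, D.
move=> nw; have [wD nirr] := imply_to_and _ _ nw; have [a wa] := not_all_ex_not _ _ nirr.
case: N a d D w IH hD ZD wD wa {nw nirr} => [|N] a d D w IH hD ZD wD wa; first by have := ltn_ord a.
apply: (IH N) => //.
pose w' := row_comp d (d a) w.
have w'D : w' *m D = 0 by rewrite -(row_comp_mulmx _ _ hD) wD raddf0.
pose c := (w 0 a)@_0%MM.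
have c0 : c != 0 by apply/eqP.
have w'a : w' 0 a = c%:MP.
  rewrite mxE subrr; apply/mpolyP => m; rewrite mcoeff_hcomp mcoeffC.
  rewrite eq_sym eqz_nat mdeg_eq0 eq_sym; case: eqP => [<-|_]; by rewrite ?mulr1 ?mulr0.
exists (fun b => d (lift a b)), (row' a D); split=> [b b'|x].
  by rewrite mxE; apply: hD.
split=> [/ZD[w0 <-]|[u <-]]; last first.
  apply/ZD; exists (\row_b (if unlift a b is Some j then u 0 j else 0)).
  rewrite !mulmx_sum_row (bigD1_ord a) //= mxE unlift_none scale0r add0r.
  by apply: eq_bigr => j _; rewrite mxE liftK; congr (_ *: _); apply/rowP => i; rewrite !mxE.
pose w1 := w0 - (w0 0 a * c^-1%:MP) *: w'.
have w1a : w1 0 a = 0.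
  have -> : w1 0 a = w0 0 a - w0 0 a * c^-1%:MP * w' 0 a by rewrite !mxE.
  by rewrite w'a -mulrA -mpolyCM mulVf // mulr1 subrr.
exists (\row_j w1 0 (lift a j)).
transitivity (w1 *m D); last by rewrite mulmxBl -scalemxAl w'D scaler0 subr0.
rewrite !mulmx_sum_row (bigD1_ord a) //= w1a scale0r add0r.
by apply: eq_bigr => j _; rewrite mxE; congr (_ *: _); apply/rowP => i; rewrite !mxE.
Qed.

End Stage.
End Existence.

(** * Existence of minimal resolutions *)

Section StageIteration.
Variables (K : fieldType) (n : nat).
Local Notation R := {mpoly K[n]}.
Local Notation anything := (fun=> True).
Implicit Types (q : int).

(** A graded free module with the submodule that the rest of the resolution
    still has to resolve. *)
Record stage := Stage {
  srank : nat;
  sdeg : 'I_srank -> int;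
  ssub : 'rV[R]_srank -> Prop }.
Arguments sdeg : clear implicits.
Arguments ssub : clear implicits.

(** The vanishing bound moves up by one at each step, so that it only has to
    exist. *)
Definition resolvable (st : stage) : Prop :=
  [/\ graded_submodule (sdeg st) (ssub st),
      forall x, ssub st x -> irrelevant_row x &
      exists bound : int, forall i q, bound < q ->
        koszul_exact i (row_piece (sdeg st) q) anything (ssub st)].

Definition covers (st : stage) (p : {st' : stage & 'M[R]_(srank st', srank st)}) : Prop :=
  [/\ forall a b, is_homogeneous (sdeg (projT1 p) a - sdeg st b) (projT2 p a b),
      forall x, ssub st x <-> exists w, w *m projT2 p = x &
      forall w, ssub (projT1 p) w <-> w *m projT2 p = 0].

(** Choose irredundant generators of the submodule; their relations are the next
    submodule, whose Koszul homology is a shift of the present one. *)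
Lemma stage_step (st : stage) : resolvable st ->
  exists p : {st' : stage & 'M[R]_(srank st', srank st)},
    covers p /\ resolvable (projT1 p).
Proof.
case: st => g deg Z [/= Zgr Zirr [bound Zex]].
have [N [d [D [hD ZD Dirr]]]] := irredundant_generators Zgr Zirr Zex.
pose st' := @Stage N d (fun w => w *m D = 0).
exists (existT (fun st' : stage => 'M[R]_(srank st', g)) st' D); split; first by split=> /=.
split=> /=; last 1 first.
- exists (bound + 1) => i q bq.
  apply: (@koszul_exact_kernel _ _ _ _ (mulmxr D) i _ (row_piece deg (q - 1))) => /=.
    move=> c cP cyc; apply: row_boundary => //.
      by move=> A cA; rewrite subrK; apply: (row_piece_mulmx hD); apply: cP.
    by move=> _; apply: Zirr; apply/ZD; exists (c set0).
  have bq1 : bound < q - 1 by rewrite ltrBrDr.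
  by apply: koszul_exact_iff (Zex i.+1 _ bq1).
- split=> [|q x xD]; last by rewrite -(row_comp_mulmx _ _ hD) xD raddf0.
  split=> [|x y xD yD|a x xD]; first by rewrite mul0mx.
    by rewrite mulmxDl xD yD addr0.
  by rewrite -scalemxAl xD scaler0.
exact: Dirr.
Qed.

Definition good_stage := {st : stage | resolvable st}.

Lemma good_stage_step (st : good_stage) :
  exists p : {st' : good_stage & 'M[R]_(srank (sval st'), srank (sval st))},
    covers (existT (fun st' => 'M[R]_(srank st', srank (sval st))) (sval (projT1 p)) (projT2 p)).
Proof.
have [[st' D] [cov res]] := stage_step (svalP st).
by exists (existT (fun st' : good_stage => 'M[R]_(srank (sval st'), srank (sval st)))
  (exist _ st' res) D).
Qed.

Definition next_stage (st : good_stage) :=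
  sval (constructive_indefinite_description _ (good_stage_step st)).

Fixpoint stages (st : good_stage) (i : nat) : good_stage :=
  if i is i'.+1 then projT1 (next_stage (stages st i')) else st.

Definition stages_resolution (st : good_stage) : gfree K n :=
  @GFree K n (fun i => srank (sval (stages st i))) (fun i => sdeg (sval (stages st i)))
    (fun i => projT2 (next_stage (stages st i))).

Lemma stages_covers (st : good_stage) i :
  [/\ forall a b, is_homogeneous (sdeg _ a - sdeg _ b) (gdiff (stages_resolution st) i a b),
      forall x, ssub (sval (stages st i)) x <->
        exists w, w *m gdiff (stages_resolution st) i = x &
      forall w, ssub (sval (stages st i.+1)) w <->
        w *m gdiff (stages_resolution st) i = 0].
Proof. exact: (svalP (constructive_indefinite_description _ (good_stage_step (stages st i)))). Qed.

Lemma stages_minimal (st : good_stage) i a b :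
  irrelevant_ideal (gdiff (stages_resolution st) i a b).
Proof.
have [_ im _] := stages_covers st i; have [_ irr _] := svalP (stages st i).
have := irr (delta_mx 0 a *m gdiff (stages_resolution st) i).
rewrite -rowE => /(_ _ b); rewrite mxE; apply; apply/im.
by exists (delta_mx 0 a); rewrite rowE.
Qed.

Lemma stages_exact (st : good_stage) i (v : 'rV_(grank (stages_resolution st) i.+1)) :
  v *m gdiff (stages_resolution st) i = 0 <->
  exists w, w *m gdiff (stages_resolution st) i.+1 = v.
Proof.
have [_ _ ker] := stages_covers st i; have [_ im _] := stages_covers st i.+1.
by split=> [/ker/im|/im/ker].
Qed.

End StageIteration.

Section ResolutionExistence.
Variables (K : fieldType) (X : finType) (D : {set {set X}}).
Local Notation n := #|X|.
Local Notation R := {mpoly K[n]}.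
Local Notation anything := (fun=> True).
Implicit Types (q r : int).
Local Notation piD := (modquot_pi (@SR_ideal K X D)).

Lemma SR_ideal_submodule : is_submodule (L := R^o) (in_SR_ideal (K := K) D).
Proof.
split; first by exists (fun=> 0); rewrite big1 // => A _; rewrite mul0r.
  move=> x y [c ->] [c' ->]; exists (fun A => c A + c' A).
  by rewrite -big_split; apply: eq_bigr => A _; rewrite mulrDl.
move=> a x [c ->]; exists (fun A => a * c A).
by rewrite [LHS]mulr_sumr; apply: eq_bigr => A _; rewrite mulrA.
Qed.

Lemma SR_ideal_irrelevant (p : R) : set0 \in D -> in_SR_ideal D p -> irrelevant_ideal p.
Proof.
move=> D0 [c ->]; rewrite /irrelevant_ideal raddf_sum big1 // => A AD /=.
have /set0Pn[x xA] : A != set0 by apply: contraNneq AD => ->.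
rewrite rmorphM /= (_ : (face_monomial K A)@_0 = 0) ?mulr0 //.
rewrite /face_monomial rmorph_prod (bigD1 x) //= mcoeffX mnm1_eq0.
by rewrite mul0r.
Qed.

Lemma minimal_resolution_exists r : set0 \in D ->
  (forall i q, r < q -> SR_exact K D i q) ->
  exists F, is_minimal_resolution (SR_piece (K := K) (D := D)) F.
Proof.
move=> D0 van.
pose Z (x : 'rV[R]_1) := in_SR_ideal D (x 0 0).
pose eps : {linear 'rV[R]_1 -> SR_module K D} := rV_comb (fun=> piD 1).
have epsE x : eps x = piD (x 0 0).
  by rewrite /eps /= /rV_comb big_ord1 -linearZ; congr (piD _); rewrite /GRing.scale /= mulr1.
have Zeps x : eps x = 0 <-> Z x by rewrite epsE SR_pi_eq0.
have onto m : exists v, eps v = m.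
  by have [p ->] := modquot_pi_surj m; exists (const_mx p); rewrite epsE mxE.
have [I0 ID IZ] := SR_ideal_submodule.
have res : resolvable (@Stage K n 1 (fun=> 0) Z).
  split=> /=.
  - split=> [|q x Zx]; last by rewrite /Z mxE; apply: SR_ideal_hcomp.
    split=> [|x y Zx Zy|a x Zx]; rewrite /Z mxE //; first exact: ID.
    exact: IZ.
  - by move=> x Zx a; rewrite ord1; apply: SR_ideal_irrelevant.
  exists r => i q rq; apply: (koszul_exact_iff Zeps).
  have /SR_exact_piece ex := van i q rq.
  apply: (koszul_exact_lift onto _ ex) => x qx.
  by exists (x 0 0); [have := qx 0; rewrite subr0|exact: epsE].
pose st0 : good_stage K n := exist _ _ res.
exists (stages_resolution st0); split; last by move=> i a b; apply: stages_minimal.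
exists eps; split=> //.
- split=> [a|i a b]; last by have [hom _ _] := stages_covers st0 i; apply: hom.
  exists 1; first exact: dhomog1.
  by rewrite epsE mxE eqxx [a]ord1.
- by move=> v; have [_ im _] := stages_covers st0 0; split=> [/Zeps/im|/im/Zeps].
by move=> i v; apply: stages_exact.
Qed.

Lemma minimal_resolution_spec r : set0 \in D ->
  (forall i q, r < q -> SR_exact K D i q) ->
  is_minimal_resolution (SR_piece (D := D)) (minimal_resolution (SR_piece (K := K) (D := D))).
Proof. by move=> D0 van; apply: epsilon_spec; apply: minimal_resolution_exists van. Qed.

Lemma SR_betti_neq0 r i q : set0 \in D ->
  (forall i q, r < q -> SR_exact K D i q) ->
  (betti (SR_piece (K := K) (D := D)) i (q + i%:Z) <> 0%N <-> ~ SR_exact K D i q).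
Proof.
move=> D0 /(minimal_resolution_spec D0)[[eps [[F1 F2] F3 F4 F5]] F6].
rewrite (minimal_generator_degree F1 F2 F3 F4 F5 F6 i q).
rewrite /betti; split=> [b0 noa|ex].
  by apply: b0; apply/eqP; rewrite cards_eq0; apply/eqP/setP => a; rewrite !inE; apply/eqP/noa.
move/eqP; rewrite cards_eq0 => /eqP/setP b0; apply: ex => a da.
by have := b0 a; rewrite !inE da eqxx.
Qed.

Lemma SR_is_reg_intro r : set0 \in D ->
  (forall i q, r < q -> SR_exact K D i q) -> (exists i, ~ SR_exact K D i r) ->
  SR_is_reg K D r.
Proof.
move=> D0 van [i nex]; split.
  exists i, (r + i%:Z); split; last by rewrite addrK.
  exact/(SR_betti_neq0 _ _ D0 van).
move=> z [i' [j [b0 ->]]]; rewrite leNgt; apply/negP => /van ex.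
by move: b0; rewrite -[j](subrK i'%:Z) => /(SR_betti_neq0 _ _ D0 van); apply.
Qed.

(** The minimal resolution has no term beyond the vanishing of Koszul homology. *)
Lemma SR_projective_resolution r l : set0 \in D ->
  (forall i q, r < q -> SR_exact K D i q) ->
  (forall i q, (l < i)%N -> SR_exact K D i q) ->
  has_projective_resolution (SR_module K D) l.
Proof.
move=> D0 van vanl; have [[eps [[F1 F2] F3 F4 F5]] F6] := minimal_resolution_spec D0 van.
set F := minimal_resolution _ in eps F1 F2 F3 F4 F5 F6.
exists (fun i => 'rV[R]_(grank F i)), (fun i => mulmxr (gdiff F i)), eps.
split=> // [i|i li x]; first exact: projective_rV.
apply/rowP => a; have ex := vanl i (gdeg a - i%:Z) li.
have := (minimal_generator_degree F1 F2 F3 F4 F5 F6 i _).1 ex a.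
by rewrite subrK.
Qed.

End ResolutionExistence.

(** * Monomial ideals *)

Section MonomialIdeals.
Variables (K : fieldType) (n : nat).
Local Notation R := {mpoly K[n]}.
Implicit Types (v : 'I_n) (A B V : {set 'I_n}) (m k : 'X_{1..n}) (q : int).
Implicit Types (S T : 'X_{1..n} -> Prop).

(** An ideal when [S] is closed under multiples. *)
Definition mono_ideal S (p : R) : Prop := forall m, p@_m != 0 -> S m.

Definition upward S : Prop := forall m m', S m -> S (m + m')%MM.

(** The monomials of the ideal generated by the variables in [V]. *)
Definition meets V m : Prop := exists2 v, v \in V & m v != 0%N.

Lemma upward_meets V : upward (meets V).
Proof. by move=> m m' [v vV mv]; exists v => //; rewrite mnmDE addn_eq0 negb_and mv. Qed.

Lemma mono_ideal_submodule S : upward S -> is_submodule (L := R^o) (mono_ideal S).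
Proof.
move=> upS; split=> [m|x y hx hy m|a x hx m]; first by rewrite mcoeff0 eqxx.
  rewrite mcoeffD; have [x0|/hx//] := eqVneq x@_m 0.
  by rewrite x0 add0r => /hy.
move=> axm; suff [k xk] : exists k, x@_(val k) != 0 /\ exists m', m = (val k + m')%MM :> 'X_{1..n}.
  by case: xk => /hx Sk [m' ->]; apply: upS.
have Pex : exists k : 'X_{1..n < (mdeg m).+1, (mdeg m).+1}, (m == (k.1 + k.2)%MM) && (x@_k.2 != 0).
  apply: NNPP => none; move/eqP: axm; apply; rewrite [LHS]mcoeffM big1 // => k mk.
  have [->|xk] := eqVneq x@_k.2 0; first by rewrite mulr0.
  by case: none; exists k; rewrite mk.
case: Pex => k /andP[/eqP mk xk]; exists (k.2); split=> //; exists (val k.1).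
by rewrite addmC.
Qed.

Lemma mono_ideal_hcomp S q p : mono_ideal S p -> mono_ideal S (hcomp q p).
Proof. by move=> hp m; rewrite mcoeff_hcomp; case: ifP => [_ /hp|]; rewrite ?eqxx. Qed.

Lemma mono_ideal_X S m : S m -> mono_ideal S 'X_[m].
Proof. by move=> Sm k; rewrite mcoeffX; case: (m =P k) => [<- //|_]; rewrite eqxx. Qed.

Lemma hcomp_kdiff q (c : {set 'I_n} -> R^o) A :
  hcomp q (kdiff c A) = kdiff (L := R^o) (fun B => hcomp (q - 1) (c B)) A.
Proof.
rewrite raddf_sum; apply: eq_bigr => v _.
exact: (hcompM _ _ (is_homogeneous_ksign K v A)).
Qed.

(** Vanishing of Koszul homology for the quotient of the ideal of [S] by that of
    [T], with bounding chains inside the ideal of [S] so that filtrations can be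
    composed. *)
Definition mono_exact S T i q : Prop :=
  koszul_exact (L := R^o) i (fun p => mono_ideal S p /\ is_homogeneous q p)
    (mono_ideal S) (mono_ideal T).

Lemma mono_exact_graded S T i q (c : {set 'I_n} -> R^o) : mono_exact S T i q -> upward T ->
  (forall A, #|A| = i -> mono_ideal S (c A) /\ is_homogeneous q (c A)) ->
  (forall A, #|A|.+1 = i -> mono_ideal T (kdiff c A)) ->
  exists c' : {set 'I_n} -> R^o, [/\ forall A, #|A| = i.+1 -> mono_ideal S (c' A),
    forall A, #|A| = i.+1 -> is_homogeneous (q - 1) (c' A) &
    forall A, #|A| = i -> mono_ideal T (c A - kdiff (L := R^o) c' A)].
Proof.
move=> ex upT cS cT; have [c' [c'S c'T]] := ex c cS cT.
exists (fun A => hcomp (q - 1) (c' A)); split=> A cA.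
- by apply: mono_ideal_hcomp; apply: c'S.
- exact: hcompP.
rewrite -hcomp_kdiff -(hcomp_id (cS A cA).2) -linearB.
by apply: mono_ideal_hcomp; apply: c'T.
Qed.

Lemma mono_exact_trans S S' T i q : upward S -> upward S' -> upward T ->
  (forall m, S' m -> S m) -> (forall m, T m -> S' m) ->
  mono_exact S S' i q -> mono_exact S' T i q -> mono_exact S T i q.
Proof.
move=> upS upS' upT S'S TS' ex ex' c cS cT.
have [|c' [c'S c'q c'S']] := mono_exact_graded ex upS' cS.
  by move=> A cA m /(cT A cA)/TS'.
have [A cA|A cA|c'' [c''S' c''T]] := ex' (fun A => c A - kdiff c' A).
- split; first exact: c'S'.
  rewrite -(hcomp_id (cS A cA).2).
  rewrite (eq_kdiff (L := R^o) (c' := fun B => hcomp (q - 1) (c' B))).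
    by rewrite -hcomp_kdiff -linearB; apply: hcompP.
  by move=> B cB; rewrite hcomp_id //; apply: c'q; rewrite cB cA.
- by rewrite kdiffB kdiff_kdiff subr0; apply: cT.
exists (fun A => c' A + c'' A); split=> A cA.
  have [_ SD _] := mono_ideal_submodule upS; apply: SD; first exact: c'S.
  by move=> m /(c''S' A cA)/S'S.
by rewrite kdiffD opprD addrA; apply: c''T.
Qed.

Lemma mono_exact_polynomial_ring i q : (0 < i)%N \/ 0 < q ->
  mono_exact (fun=> True) (meets set0) i q.
Proof.
move=> iq c cq cyc.
have van p : mono_ideal (meets set0) p -> p = 0.
  move=> hp; apply/mpolyP => m; rewrite mcoeff0; apply/eqP/negPn/negP => /hp[v].
  by rewrite inE.
have zero : mono_ideal (meets set0) 0 by case: (mono_ideal_submodule (@upward_meets set0)).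
have [i0|i0] := posnP i; last first.
  have [//|A cA|c' [_ c'E]] := koszul_acyclic (@divides_variables_free K n) i0 (c := c).
    exact/van/cyc.
  by exists c'; split=> // A cA; rewrite c'E.
rewrite i0 in iq cq cyc *; case: iq => // q0.
have [||//|b bE] := @irrelevant_boundary K n R^o (fun x => x = 0) (c set0) 0%N (fun=> 1).
- by split=> [//|x y -> ->|a x ->]; rewrite ?addr0 ?scaler0.
- apply/eqP/negPn/negP => c0; have /is_homogeneousP/(_ _ c0) := (cq set0 (cards0 _)).2.
  by move=> qE; rewrite qE mdeg0 in q0.
exists b; split=> // A /eqP; rewrite cards_eq0 => /eqP ->.
have := bE set0 (cards0 _); rewrite [_ *: _]mulr1 => ->.
exact: zero.
Qed.

Lemma meetsU_iff V v p : mono_ideal (meets (v |: V)) p <->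
  exists y r, mono_ideal (meets V) y /\ p = y + 'X_v * r.
Proof.
split=> [hp|[y [r [hy ->]]]].
  exists (p - 'X_v * mdiv U_(v) p), (mdiv U_(v) p); rewrite subrK; split=> // m.
  rewrite mcoeffB mcoeff_XM mcoeff_mdiv lep1mP.
  case: ifP => [mv|mv]; first by rewrite submK ?lep1mP // subrr eqxx.
  rewrite subr0 => /hp[w]; rewrite inE => /orP[/set1P ->|wV]; last by exists w.
  by rewrite mv.
have [_ vD _] := mono_ideal_submodule (@upward_meets (v |: V)); apply: vD => m.
  by move=> /hy[w wV mw]; exists w => //; rewrite inE wV orbT.
rewrite mcoeff_XM lep1mP; case: ifP => [mv _|]; last by rewrite eqxx.
by exists v; rewrite ?setU11.
Qed.

Lemma meets_regular V v p : v \notin V ->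
  mono_ideal (meets V) ('X_v * p) -> mono_ideal (meets V) p.
Proof.
move=> vV hp m pm; have [|w wV] := hp (U_(v) + m)%MM.
  by rewrite mcoeff_XM lem_addr addmC addmK.
rewrite mnmDE mnm1E; case: (v =P w) => [vw|_]; last by move=> mw; exists w.
by rewrite vw wV in vV.
Qed.

(** Dividing by one more variable [x]: as [x] is regular modulo the others, the
    homology of the quotient by [x] is made of the homology before, in degrees
    [i] and [i - 1] of the same [q]. *)
Lemma mono_exact_meetsU V v i q : v \notin V ->
  mono_exact (fun=> True) (meets V) i q ->
  (forall j, i = j.+1 -> mono_exact (fun=> True) (meets V) j q) ->
  mono_exact (fun=> True) (meets (v |: V)) i q.
Proof.
move=> vV ex exp c cq cyc.
have upV := @upward_meets V; have Vmod := mono_ideal_submodule upV.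
case: i => [|j] in ex exp cq cyc *.
  have [c' [c'S c'T]] := ex c cq (fun A e => False_ind _ (O_S _ (esym e))).
  exists c'; split=> // A cA; apply/meetsU_iff; exists (c A - kdiff c' A), 0.
  by rewrite mulr0 addr0; split=> //; apply: c'T.
have [A cA|b bE] := @chain_lift n R^o j
   (fun A r => is_homogeneous q r /\ mono_ideal (meets V) (kdiff c A - 'X_v * r)) 0.
  have dch : is_homogeneous (q + 1) (kdiff c A).
    have -> : kdiff c A = hcomp (q + 1) (kdiff c A); last exact: hcompP.
    rewrite hcomp_kdiff; apply: eq_kdiff => B cB; rewrite addrK hcomp_id //.
    by have [] := cq B; rewrite ?cB ?cA.
  have /meetsU_iff[y [r [hy rE]]] := cyc A (congr1 S cA).
  exists (hcomp q r); split; first exact: hcompP.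
  rewrite -(hcomp_id dch) -[q in hcomp q r](addrK 1).
  rewrite -(hcompM _ _ (is_homogeneous_var K v)) -linearB rE addrK.
  exact: mono_ideal_hcomp.
have [A cA|A cA|b' [_ b'q b'E]] := mono_exact_graded (exp j erefl) upV (c := b).
- by have [] := bE A cA.
- apply: (meets_regular vV); have -> : 'X_v * kdiff (L := R^o) b A =
      0 - kdiff (L := R^o) (fun B => kdiff c B - 'X_v * b B) A.
    by rewrite kdiffB kdiff_kdiff !sub0r opprK; apply/esym/(kdiffZ (L := R^o)).
  apply: (submodB Vmod); first by case: Vmod.
  by apply: submod_kdiff => // B cB; have [] := bE B; rewrite ?cB ?cA.
pose c1 A : R^o := c A - 'X_v * b' A.
have [A cA|A [cA]|c' [_ c'E]] := ex c1.
- split=> //; apply: (is_homogeneousB (cq A cA).2).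
  by have := is_homogeneousM (is_homogeneous_var K v) (b'q A cA); rewrite addrC subrK.
- have -> : kdiff c1 A = (kdiff c A - 'X_v * b A) + 'X_v * (b A - kdiff (L := R^o) b' A).
    rewrite mulrBr addrA subrK kdiffB; congr (_ - _); exact: (kdiffZ (L := R^o)).
  have [_ VD VZ] := Vmod; apply: VD; first by have [] := bE A cA.
  by apply: VZ; apply: b'E.
exists c'; split=> // A cA.
apply/meetsU_iff; exists (c1 A - kdiff (L := R^o) c' A), (b' A).
by split; [exact: c'E|rewrite /c1 addrAC subrK].
Qed.

End MonomialIdeals.

(** * Filtrations by shifted polynomial rings *)

Section IntervalStep.
Variables (K : fieldType) (n : nat).
Local Notation R := {mpoly K[n]}.
Implicit Types (v : 'I_n) (A B V : {set 'I_n}) (m k : 'X_{1..n}) (q : int).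
Implicit Types (S T : 'X_{1..n} -> Prop).

Lemma mono_exact_meets V i q : (#|V| < i)%N \/ 0 < q ->
  @mono_exact K n (fun=> True) (meets V) i q.
Proof.
move cV : #|V| => c; elim: c V cV i => [|c IH] V cV i iq.
  by move/eqP: cV; rewrite cards_eq0 => /eqP ->; apply: mono_exact_polynomial_ring.
have /card_gt0P[v vV] : (0 < #|V|)%N by rewrite cV.
have cV' : #|V :\ v| = c by move: cV; rewrite (cardsD1 v) vV => -[].
rewrite -(setD1K vV); apply: mono_exact_meetsU; first by rewrite !inE eqxx.
  by apply: IH => //; case: iq => [/ltnW|]; [left|right].
by move=> j ij; apply: IH => //; case: iq; rewrite ?ij ?ltnS; [left|right].
Qed.

(** [S] modulo [T] is the polynomial ring on the variables outside [V], shifted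
    by the monomial [g]: the monomials in [S] and not in [T] are the multiples
    of [g] by monomials that avoid [V]. *)
Definition interval_step S T g V : Prop :=
  [/\ upward S, upward T, forall m, T m -> S m, S g &
    (forall m, S m -> T m \/ (g <= m)%MM) /\
    forall m, T (g + m)%MM <-> meets V m].

Section Step.
Variables (S T : 'X_{1..n} -> Prop) (g : 'X_{1..n}) (V : {set 'I_n}).
Hypothesis ST : interval_step S T g V.
Implicit Types (p : R).

Lemma step_upS : upward S. Proof. by case: ST. Qed.
Lemma step_upT : upward T. Proof. by case: ST. Qed.

Lemma step_split p : mono_ideal S p -> mono_ideal T (p - 'X_[g] * mdiv g p).
Proof.
case: ST => _ _ _ _ [Sg _] hp m; rewrite mcoeffB mcoeff_XM mcoeff_mdiv.
case: ifP => [gm|gm]; first by rewrite submK // subrr eqxx.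
by rewrite subr0 => /hp/Sg[|gm'] //; rewrite gm' in gm.
Qed.

Lemma step_mem p : mono_ideal S ('X_[g] * p).
Proof.
have [upS _ _ Sg _] := ST; have [_ _ SZ] := mono_ideal_submodule K upS.
by rewrite mulrC; apply: SZ; apply: mono_ideal_X.
Qed.

Lemma step_iff p : mono_ideal T ('X_[g] * p) <-> mono_ideal (meets V) p.
Proof.
have [_ _ _ _ [_ Tg]] := ST; split=> hp m.
  by move=> pm; apply/Tg; apply: hp; rewrite mcoeff_XM lem_addr addmC addmK.
rewrite mcoeff_XM; case: ifP => [gm pm|]; last by rewrite eqxx.
by rewrite -(submK gm) addmC; apply/Tg/hp.
Qed.

(** Multiplication by [g] identifies the step with a polynomial ring shifted by
    the degree of [g]. *)
Lemma step_exact i q : (#|V| < i)%N \/ (mdeg g)%:Z < q -> @mono_exact K n S T i q.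
Proof.
move=> iq c cS cT.
have Tmod := mono_ideal_submodule K step_upT; have [T0 TD TZ] := Tmod.
pose a A : R^o := mdiv g (c A).
have [|A cA|A cA|a' [_ a'V]] := @mono_exact_meets V i (q - (mdeg g)%:Z) _ a.
- by case: iq; [left|rewrite subr_gt0; right].
- split=> //; apply/is_homogeneousP => m; rewrite mcoeff_mdiv => cm.
  by have /is_homogeneousP/(_ _ cm) := (cS A cA).2; rewrite mdegD PoszD => ->; rewrite addrK.
- apply/step_iff.
  have -> : 'X_[g] * kdiff (L := R^o) a A =
      kdiff c A - kdiff (L := R^o) (fun B => c B - 'X_[g] * a B) A.
    by rewrite kdiffB opprB addrC subrK; apply/esym/(kdiffZ (L := R^o)).
  apply: (submodB Tmod); first exact: cT.
  by apply: submod_kdiff => // B cB; apply: step_split; have [] := cS B; rewrite ?cB ?cA.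
exists (fun A => 'X_[g] * a' A); split=> A cA; first exact: step_mem.
have -> : c A - kdiff (L := R^o) (fun B => 'X_[g] * a' B) A =
    (c A - 'X_[g] * a A) + 'X_[g] * (a A - kdiff (L := R^o) a' A).
  rewrite mulrBr addrA subrK; congr (_ - _); exact: (kdiffZ (L := R^o)).
apply: TD; first by apply: step_split; have [] := cS A cA.
by apply/step_iff; apply: a'V.
Qed.

End Step.
End IntervalStep.

Section WeaklyRegular.
Variables (R : comNzRingType) (f : nat -> R).
Implicit Types (P Q T : R -> Prop) (j t : nat).

Definition ideal_like P : Prop :=
  [/\ P 0, forall x y, P x -> P y -> P (x + y) & forall a x, P x -> P (a * x)].

Lemma ideal_likeB P x y : ideal_like P -> P x -> P y -> P (x - y).
Proof. by case=> _ PD PM Px Py; apply: PD => //; rewrite -mulN1r; apply: PM. Qed.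

(** [Q + (f 0, ..., f (j - 1)) P] *)
Fixpoint extend P Q j (x : R) : Prop :=
  if j is j'.+1 then exists y p, [/\ extend P Q j' y, P p & x = y + f j' * p] else Q x.

Definition weakly_regular P Q t : Prop :=
  forall j p, (j < t)%N -> P p -> extend P Q j (f j * p) -> extend P Q j p.

Lemma extend_ideal P Q j : ideal_like P -> ideal_like Q -> ideal_like (extend P Q j).
Proof.
move=> Pid Qid; elim: j => //= j [E0 ED EM]; have [P0 PD PM] := Pid; split.
- by exists 0, 0; rewrite mulr0 addr0.
- move=> _ _ [y [p [Ey Pp ->]]] [z [r [Ez Pr ->]]]; exists (y + z), (p + r).
  by split; [exact: ED|exact: PD|rewrite mulrDr addrACA].
move=> a _ [y [p [Ey Pp ->]]]; exists (a * y), (a * p).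
by split; [exact: EM|exact: PM|rewrite mulrDr mulrCA].
Qed.

Lemma extend_incl P Q j : P 0 -> forall x, Q x -> extend P Q j x.
Proof. by move=> P0; elim: j => //= j IH x Qx; exists x, 0; rewrite mulr0 addr0; split; auto. Qed.

Lemma extend_mono P P' Q Q' j : (forall x, P x -> P' x) -> (forall x, Q x -> Q' x) ->
  forall x, extend P Q j x -> extend P' Q' j x.
Proof.
move=> PP QQ; elim: j => //= j IH x [y [p [Ey Pp ->]]].
by exists y, p; split=> //; [apply: IH|apply: PP].
Qed.

Lemma extend_split P Q T j : Q 0 -> T 0 -> (forall x y, Q x -> Q y -> Q (x + y)) ->
  forall x, extend P Q j x -> exists y z, [/\ Q y, extend P T j z & x = y + z].
Proof.
move=> Q0 T0 QD; elim: j => [|j IH] /= x; first by move=> Qx; exists x, 0; rewrite addr0.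
case=> y [p [/IH[y1 [z1 [Qy1 Ez1 ->]]] Pp ->]]; exists y1, (z1 + f j * p).
by rewrite addrA; split=> //; exists z1, p.
Qed.

(** Regularity on [P / Q] makes [Q / T -> P / T] stay injective modulo the
    sequence, so that regularity passes to extensions. *)
Lemma weakly_regular_trans P Q T t : ideal_like P -> ideal_like Q -> ideal_like T ->
  (forall x, Q x -> P x) -> (forall x, T x -> Q x) ->
  weakly_regular P Q t -> weakly_regular Q T t -> weakly_regular P T t.
Proof.
move=> Pid Qid Tid QP TQ regPQ regQT.
have [P0 PD PM] := Pid; have [Q0 QD QM] := Qid; have [T0 TD TM] := Tid.
have inj : forall j, (j <= t)%N -> forall x, Q x -> extend P T j x -> extend Q T j x.
  elim=> [//|j IH] jt x Qx /= [y [p [Ey Pp xE]]].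
  have Efp : extend P Q j (f j * p).
    have -> : f j * p = x - y by rewrite xE addrC addKr.
    apply: (ideal_likeB (extend_ideal j Pid Qid)); first exact: extend_incl.
    by apply: extend_mono Ey.
  have [q [z [Qq Ez pE]]] := extend_split Q0 T0 QD (regPQ j p jt Pp Efp).
  exists (x - f j * q), q; split=> //; last by rewrite subrK.
  apply: IH; [exact: ltnW|by apply: ideal_likeB => //; apply: QM|].
  have -> : x - f j * q = y + f j * z by rewrite xE pE mulrDr addrA addrAC addrK.
  by have [_ ED EM] := extend_ideal j Pid Tid; apply: ED => //; apply: EM.
move=> j p jt Pp Efp.
have EQ : extend P Q j (f j * p) by apply: extend_mono Efp.
have [q [z [Qq Ez pE]]] := extend_split Q0 T0 QD (regPQ j p jt Pp EQ).
have [_ ED EM] := extend_ideal j Pid Tid.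
rewrite pE; apply: ED => //.
apply: (@extend_mono Q P T T) => //; apply: regQT => //; apply: inj (ltnW jt) _ _ _.
  exact: QM.
have -> : f j * q = f j * p - f j * z by rewrite pE mulrDr addrK.
by apply: (ideal_likeB (extend_ideal j Pid Tid)) => //; apply: EM.
Qed.

End WeaklyRegular.

Section StepRegular.
Variables (K : fieldType) (n : nat) (f : nat -> {mpoly K[n]}).
Local Notation R := {mpoly K[n]}.
Variables (S T : 'X_{1..n} -> Prop) (g : 'X_{1..n}) (V : {set 'I_n}).
Hypothesis ST : interval_step S T g V.
Local Notation IS := (@mono_ideal K n S).
Local Notation IT := (@mono_ideal K n T).
Local Notation IV := (@mono_ideal K n (meets V)).

Lemma step_extend j x : extend f IS IT j x ->
  exists2 a, extend f (fun=> True) IV j a & IT (x - 'X_[g] * a).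
Proof.
have [T0 TD TZ] := mono_ideal_submodule K (step_upT ST).
have [V0 _ _] := mono_ideal_submodule K (@upward_meets n V).
elim: j x => [|j IH] x /=; first by exists 0; rewrite ?mulr0 ?subr0.
move=> [y [p [/IH[a Ea Ta] Sp ->]]].
exists (a + f j * mdiv g p); first by exists a, (mdiv g p).
have -> : y + f j * p - 'X_[g] * (a + f j * mdiv g p) =
  (y - 'X_[g] * a) + f j * (p - 'X_[g] * mdiv g p) by ring.
by apply: TD => //; apply: (TZ (f j)); apply: (step_split ST).
Qed.

Lemma extend_step j a : extend f (fun=> True) IV j a -> extend f IS IT j ('X_[g] * a).
Proof.
elim: j a => [|j IH] a /=; first by move/(step_iff ST).
move=> [y [p [/IH Ey _ ->]]]; exists ('X_[g] * y), ('X_[g] * p); split=> //.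
  exact: (step_mem ST).
by ring.
Qed.

Lemma step_regular t : weakly_regular f (fun=> True) IV t -> weakly_regular f IS IT t.
Proof.
move=> reg j p jt Sp /step_extend[a1 Ea1 Ta1].
have Tmod := mono_ideal_submodule K (step_upT ST); have [T0 TD TZ] := Tmod.
have Smod := mono_ideal_submodule K (step_upS ST).
have Vmod := mono_ideal_submodule K (@upward_meets n V).
have Eid := extend_ideal f j Smod Tmod; have [_ ED EM] := Eid.
have EVid : ideal_like (extend f (fun=> True) IV j) by apply: extend_ideal.
have [_ EVD _] := EVid.
pose a := mdiv g p.
have Ea : extend f (fun=> True) IV j (f j * a).
  rewrite -[f j * a](subrK a1); apply: EVD => //.
  apply: extend_incl => //; apply/(step_iff ST).
  have -> : 'X_[g] * (f j * a - a1) =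
     (f j * p - 'X_[g] * a1) - f j * (p - 'X_[g] * a) by ring.
  apply: (submodB (L := R^o) Tmod) => //; apply: (TZ (f j)); exact: (step_split ST).
rewrite -[p](subrK ('X_[g] * a)); apply: ED.
  by apply: extend_incl; [case: Smod|apply: (step_split ST)].
by apply: extend_step; apply: reg.
Qed.

End StepRegular.

(** * Elementary symmetric polynomials form regular sequences *)

Section ElementarySymmetric.
Variables (K : fieldType) (n : nat).
Local Notation R := {mpoly K[n]}.
Implicit Types (v : 'I_n) (F : {set 'I_n}) (p x y r : R) (J : R -> Prop).

Lemma graded_separated J v x : ideal_like J -> (forall q y, J y -> J (hcomp q y)) ->
  (forall k, exists y p, J y /\ x = y + 'X_v ^+ k * p) -> J x.
Proof.
move=> [J0 JD JM] Jgr sep.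
suff comp (d : nat) : J (hcomp d x).
  rewrite (@pihomog_partitionE _ _ mdeg (msize x) x) //.
  by apply: big_ind => // d _; apply: (comp d).
have [y [p [Jy ->]]] := sep d.+1; rewrite linearD.
have hX k : is_homogeneous k%:Z ('X_v ^+ k : R).
  elim: k => [|k IH]; first exact: dhomog1.
  by rewrite exprS intS; apply: is_homogeneousM IH; apply: is_homogeneous_var.
apply: JD; first exact: (Jgr d).
have := @hcompM K n d.+1 d _ p (hX d.+1); rewrite /= => ->.
have -> : d%:Z - d.+1%:Z = Negz 0 by rewrite intS; lia.
by rewrite mulr0.
Qed.

(** Two regular elements can be exchanged when the first is a variable and the
    ideal is graded: an element divisible by all powers of the variable is zero. *)
Lemma regular_exchange J v (e : R) : ideal_like J -> (forall q y, J y -> J (hcomp q y)) ->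
  (forall p, J ('X_v * p) -> J p) ->
  (forall p, (exists y r, J y /\ e * p = y + 'X_v * r) -> exists y r, J y /\ p = y + 'X_v * r) ->
  (forall p, J (e * p) -> J p) /\
  (forall p, (exists y r, J y /\ 'X_v * p = y + e * r) -> exists y r, J y /\ p = y + e * r).
Proof.
move=> Jid Jgr regv rege; have [J0 JD JM] := Jid; split=> [p Jep|p [y [r [Jy E]]]].
  apply: (graded_separated (v := v) Jid Jgr) => k; elim: k p Jep => [|k IH] p Jep.
    by exists 0, p; rewrite add0r mul1r.
  have [|y [r [Jy pE]]] := rege p; first by exists (e * p), 0; rewrite mulr0 addr0.
  have [|y' [r' [Jy' rE]]] := IH r.
    apply: regv; have -> : 'X_v * (e * r) = e * p - e * y by rewrite pE; ring.
    by apply: ideal_likeB => //; apply: JM.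
  exists (y + 'X_v * y'), r'; split; first by apply: JD => //; apply: JM.
  by rewrite pE rE exprS; ring.
have [|y1 [r1 [Jy1 rE]]] := rege r.
  by exists (- y), p; split; [rewrite -mulN1r; apply: JM|rewrite E addKr].
exists (p - e * r1), r1; split; last by rewrite subrK.
apply: regv; have -> : 'X_v * (p - e * r1) = y + e * y1 by rewrite mulrBr E rE; ring.
by apply: JD => //; apply: JM.
Qed.

Definition elem_sym (j : nat) : R := mesym n K j.+1.

(** The ideal of [e_1, ..., e_j] and of the variables outside [F]. *)
Definition elem_sym_ideal F j : R -> Prop :=
  extend elem_sym (fun=> True) (mono_ideal (meets (~: F))) j.

Lemma elem_sym_ideal_like F j : ideal_like (elem_sym_ideal F j).
Proof.
apply: extend_ideal; first by [].
exact: (mono_ideal_submodule K (@upward_meets n (~: F))).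
Qed.

Lemma elem_sym_ideal_hcomp F j q y : elem_sym_ideal F j y -> elem_sym_ideal F j (hcomp q y).
Proof.
elim: j q y => [|j IH] q y /=; first exact: mono_ideal_hcomp.
move=> [x [p [Ex _ ->]]]; exists (hcomp q x), (hcomp (q - j.+1%:Z) p); split=> //; first exact: IH.
by rewrite linearD; congr (_ + _); apply: (@hcompM K n j.+1%:Z); apply: dhomog_mesym.
Qed.

Lemma elem_sym_idealD1 F v j x : v \in F ->
  elem_sym_ideal (F :\ v) j x <-> exists y r, elem_sym_ideal F j y /\ x = y + 'X_v * r.
Proof.
move=> vF; elim: j x => [|j IH] x /=.
  by rewrite /elem_sym_ideal /= setCD setUC; exact: meetsU_iff.
split=> [[_ [p [/IH[y [r [Ey ->]]] _ ->]]]|[_ [r [[y [p [Ey _ ->]]] ->]]]].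
  by exists (y + elem_sym j * p), r; split; [exists y, p|ring].
exists (y + 'X_v * r), p; split=> //; last by ring.
by apply/IH; exists y, r.
Qed.

(** Modulo the variables outside [F] only one term of [e_s], [s = #|F|], is left. *)
Lemma elem_sym_top F s : #|F| = s.+1 ->
  mono_ideal (meets (~: F)) (elem_sym s - \prod_(v in F) 'X_v).
Proof.
move=> cF; rewrite /elem_sym /mesym (bigD1 F) ?cF //= addrAC subrr add0r.
have [V0 VD VZ] := mono_ideal_submodule K (@upward_meets n (~: F)).
apply: (big_ind (mono_ideal (meets (~: F)))) => // B /andP[/eqP cB BF].
have [w wB wF] : exists2 w, w \in B & w \notin F.
  by apply/subsetPn; apply: contra BF => BF; rewrite eqEcard BF cB cF leqnn.
rewrite (bigD1 w) //= mulrC; apply: VZ.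
by apply: mono_ideal_X; exists w; rewrite ?inE // mnm1E eqxx.
Qed.

(** Induction on [F]. Adding a variable [v] of [F] to the ideal removes [v] from
    [F], where the next elementary polynomial is regular by induction; exchanging
    it with [v] makes both regular. The last one, [e_s] with [s = #|F|], is the
    product of the variables of [F], each of which is regular by then. *)
Lemma elem_sym_regular s F : #|F| = s ->
  (forall j p, (j < s)%N -> elem_sym_ideal F j (elem_sym j * p) -> elem_sym_ideal F j p) /\
  (forall v j p, v \in F -> (j < s)%N -> elem_sym_ideal F j ('X_v * p) -> elem_sym_ideal F j p).
Proof.
elim: s F => [|s IH] F cF; first by [].
have cFv v : v \in F -> #|F :\ v| = s by move=> vF; move: cF; rewrite (cardsD1 v) vF => -[].
have rege v j : v \in F -> (j < s)%N -> forall p,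
    (exists y r, elem_sym_ideal F j y /\ elem_sym j * p = y + 'X_v * r) ->
    exists y r, elem_sym_ideal F j y /\ p = y + 'X_v * r.
  move=> vF js p /(elem_sym_idealD1 _ _ vF) E; apply/(elem_sym_idealD1 _ _ vF).
  exact: (IH _ (cFv v vF)).1.
have regv v : v \in F -> forall j, (j <= s)%N ->
    forall p, elem_sym_ideal F j ('X_v * p) -> elem_sym_ideal F j p.
  move=> vF; elim=> [|j IHj] js p; first by apply: meets_regular; rewrite inE vF.
  have [_ ex] := regular_exchange (elem_sym_ideal_like F j) (@elem_sym_ideal_hcomp F j)
     (IHj (ltnW js)) (rege v j vF js).
  move=> [y [r [Ey _ E]]]; have [|y' [r' [Ey' ->]]] := ex p; first by exists y, r.
  by exists y', r'.
split=> [j p|v j p vF js]; last exact: regv.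
rewrite ltnS leq_eqVlt => /orP[/eqP -> {j}|js]; last first.
  have /card_gt0P[v vF] : (0 < #|F|)%N by rewrite cF.
  have [reg _] := regular_exchange (elem_sym_ideal_like F j) (@elem_sym_ideal_hcomp F j)
     (regv v vF j (ltnW js)) (rege v j vF js).
  exact: reg.
have Eid := elem_sym_ideal_like F s; have [_ ED EM] := Eid => Ep.
have : elem_sym_ideal F s (\prod_(v in F) 'X_v * p).
  have -> : \prod_(v in F) 'X_v * p =
    elem_sym s * p - p * (elem_sym s - \prod_(v in F) 'X_v) by ring.
  apply: ideal_likeB => //; apply: EM; apply: extend_incl => //; exact: elem_sym_top.
rewrite -big_enum /=; have sub : {subset enum F <= F} by move=> v; rewrite mem_enum.
elim: (enum F) sub {Ep} => [|v l IHl] sub; first by rewrite big_nil mul1r.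
rewrite big_cons -mulrA => /(regv v (sub v (mem_head _ _)) s (leqnn _)); apply: IHl => w wl.
by apply: sub; rewrite inE wl orbT.
Qed.

Lemma elem_sym_weakly_regular F t : (t <= #|F|)%N ->
  weakly_regular elem_sym (fun=> True) (mono_ideal (meets (~: F))) t.
Proof.
move=> tF j p jt _; apply: (elem_sym_regular (erefl #|F|)).1.
exact: leq_trans jt tF.
Qed.

End ElementarySymmetric.

(** * Complexes built from intervals of faces *)

Section NonFaces.
Variables (K : fieldType) (X : finType).
Local Notation n := #|X|.
Local Notation R := {mpoly K[n]}.
Implicit Types (D : {set {set X}}) (A B F G : {set X}) (m : 'X_{1..n}).

Definition is_complex D : Prop := forall A B, A \in D -> B \subset A -> B \in D.

Definition msupport m : {set X} := [set x | m (enum_rank x) != 0%N].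

Definition mset A : 'X_{1..n} := (\sum_(x in A) U_(enum_rank x))%MM.

Definition nonface D m : Prop := msupport m \notin D.

Lemma face_monomialE A : face_monomial K A = 'X_[mset A].
Proof. by rewrite /face_monomial /mset mprodXE. Qed.

Lemma msetE A x : mset A (enum_rank x) = (x \in A).
Proof.
rewrite /mset mnm_sumE; case: (boolP (x \in A)) => xA.
  rewrite (bigD1 x) //= mnm1E eqxx big1 // => y /andP[_ yx].
  by rewrite mnm1E (inj_eq enum_rank_inj) (negbTE yx).
rewrite big1 // => y yA; rewrite mnm1E (inj_eq enum_rank_inj).
by case: eqP => // yx; rewrite -yx yA in xA.
Qed.

Lemma mdeg_mset A : mdeg (mset A) = #|A|.
Proof. by rewrite /mset mdeg_sum -[RHS]sum1_card; apply: eq_bigr => x _; rewrite mdeg1. Qed.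

Lemma msupport_mset A : msupport (mset A) = A.
Proof. by apply/setP => x; rewrite inE msetE; case: (x \in A). Qed.

Lemma msupportD m m' : msupport (m + m') = msupport m :|: msupport m'.
Proof. by apply/setP => x; rewrite !inE mnmDE addn_eq0 negb_and. Qed.

Lemma mset_le A m : (mset A <= m)%MM = (A \subset msupport m).
Proof.
apply/mnm_lepP/subsetP => [le x xA|sub i].
  by rewrite inE -lt0n; apply: leq_trans (le _); rewrite msetE xA.
rewrite -(enum_valK i) msetE; case: (boolP (_ \in A)) => // /sub.
by rewrite inE lt0n.
Qed.

Lemma upward_nonface D : is_complex D -> upward (nonface D).
Proof.
move=> Dc m m'; apply: contra; rewrite msupportD => mD.
by apply: Dc mD _; apply: subsetUl.
Qed.

(** A monomial outside the complex is a multiple of the squarefree monomial on its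
    support. *)
Lemma in_SR_idealE D (p : R) : is_complex D ->
  in_SR_ideal D p <-> mono_ideal (nonface D) p.
Proof.
move=> Dc; have [M0 MD MZ] := mono_ideal_submodule K (upward_nonface Dc).
have [I0 ID IZ] := @SR_ideal_submodule K X D.
split=> [[c ->]|hp].
  apply: (big_ind (mono_ideal (nonface D))) => // A AD; apply: (MZ (c A)).
  by rewrite face_monomialE; apply: mono_ideal_X; rewrite /nonface msupport_mset.
rewrite (mpolyE p) big_seq; apply: (big_ind (in_SR_ideal D)) => // m.
rewrite mcoeff_msupp => /hp mD; have le : (mset (msupport m) <= m)%MM by rewrite mset_le.
rewrite -mul_mpolyC -(submK le) mpolyXD mulrA -face_monomialE; apply: (IZ (_ * _)).
exists (fun A => if A == msupport m then 1 else 0).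
rewrite (bigD1 (msupport m)) //= eqxx mul1r big1 ?addr0 // => A /andP[_ Am].
by rewrite (negbTE Am) mul0r.
Qed.

Definition face_interval G F : {set {set X}} := [set B : {set X} | (G \subset B) && (B \subset F)].

(** A complex built by adding intervals [G <= B <= F] of faces: each step
    enlarges the Stanley-Reisner ring by a shifted polynomial ring on [F]. The
    sizes [#|F|] bound depth from below and the sizes [#|G|] regularity from above. *)
Inductive interval_built (t r : nat) : {set {set X}} -> Prop :=
| interval_built0 : interval_built t r set0
| interval_builtU D F G : interval_built t r D -> is_complex (D :|: face_interval G F) ->
    G \subset F -> [disjoint D & face_interval G F] -> (t <= #|F|)%N -> (#|G| <= r)%N ->
    interval_built t r (D :|: face_interval G F).

Lemma interval_built_complex t r D : interval_built t r D -> is_complex D.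
Proof. by case=> // A B; rewrite inE. Qed.

Lemma nonface_step D F G : is_complex D -> is_complex (D :|: face_interval G F) ->
  G \subset F -> [disjoint D & face_interval G F] ->
  interval_step (nonface D) (nonface (D :|: face_interval G F)) (mset G) (~: (enum_rank @: F)).
Proof.
move=> Dc D'c GF dis; split; try exact: upward_nonface.
- by move=> m; apply: contra => mD; rewrite inE mD.
- rewrite /nonface msupport_mset; apply: contraTN (dis) => GD.
  by apply/pred0Pn; exists G; rewrite /= GD inE subxx.
split=> m.
  rewrite /nonface => mD; have [mI|mI] := boolP (msupport m \in face_interval G F).
    by right; rewrite mset_le; move: mI; rewrite inE => /andP[].
  by left; rewrite inE negb_or mD.
rewrite /nonface msupportD msupport_mset.
have -> : (G :|: msupport m \notin D :|: face_interval G F) = ~~ (msupport m \subset F).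
  have [mF|mF] := boolP (msupport m \subset F).
    by apply/negbF; rewrite !inE subsetUl subUset GF mF orbT.
  rewrite !inE subsetUl subUset GF (negbTE mF) orbF /=.
  apply: contraTN dis => GmD; apply/pred0Pn; exists G.
  by rewrite /= (Dc _ _ GmD (subsetUl _ _)) inE subxx.
split=> [/subsetPn[x]|[i]].
  rewrite inE => mx xF; exists (enum_rank x) => //.
  by rewrite inE; apply: contra xF => /imsetP[y yF /enum_rank_inj ->].
rewrite inE => iF mi; apply/subsetPn; exists (enum_val i).
  by rewrite inE enum_valK.
by apply: contra iF => iF; rewrite -(enum_valK i) imset_f.
Qed.

Lemma interval_built_exact t r D i (q : int) : interval_built t r D ->
  (n < i + t)%N \/ r%:Z < q -> @mono_exact K n (fun=> True) (nonface D) i q.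
Proof.
move=> built iq; elim: built => [|D' F G built IH D'c GF dis tF Gr].
  by move=> c _ _; exists (fun=> 0); split=> // A cA m; rewrite /nonface inE.
have Dc := interval_built_complex built; have st := nonface_step Dc D'c GF dis.
apply: (@mono_exact_trans K n _ (nonface D')) => //.
- exact: upward_nonface.
- exact: upward_nonface.
- by case: st.
apply: (step_exact st); case: iq => [ni|rq]; [left|right].
  have cn : (#|F| + #|~: (enum_rank @: F)| = n)%N.
    by rewrite -(card_imset (mem F) enum_rank_inj) cardsC card_ord.
  rewrite -(ltn_add2r t); apply: leq_ltn_trans ni; apply: leq_trans (eq_leq cn).
  by rewrite addnC leq_add2r.
by apply: le_lt_trans rq; rewrite mdeg_mset lez_nat.
Qed.

Lemma interval_built_regular t r D : interval_built t r D ->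
  weakly_regular (@elem_sym K n) (fun=> True) (mono_ideal (nonface D)) t.
Proof.
elim=> [|D' F G built IH D'c GF dis tF Gr].
  by move=> j p _ _ _; apply: extend_incl => // m; rewrite /nonface inE.
have Dc := interval_built_complex built; have st := nonface_step Dc D'c GF dis.
apply: (weakly_regular_trans _ _ _ _ _ IH) => //.
- exact: (mono_ideal_submodule K (upward_nonface Dc)).
- exact: (mono_ideal_submodule K (upward_nonface D'c)).
- by case: st => _ _ sub _ _ p hp m /hp/sub.
apply: (step_regular st); apply: elem_sym_weakly_regular.
by rewrite (card_imset _ enum_rank_inj).
Qed.

Lemma SR_exact_mono D i (q : int) : is_complex D ->
  SR_exact K D i q <-> @mono_exact K n (fun=> True) (nonface D) i q.
Proof.
move=> Dc; have iffI (p : R^o) := in_SR_idealE p Dc; split=> ex.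
  apply: (koszul_exact_iff iffI).
  by apply: (@koszul_exact_weaken K n R^o i _ _ _ _ _ _ _ ex) => // p [].
apply: (koszul_exact_iff (fun p => iff_sym (iffI p))).
by apply: (@koszul_exact_weaken K n R^o i _ _ _ _ _ _ _ ex).
Qed.

Lemma seq_smul_extend D fs (p : R) : 
  seq_smul fs (modquot_pi (@SR_ideal K X D) p) <->
  extend (nth 0 fs) (fun=> True) (in_SR_ideal D) (size fs) p.
Proof.
elim/last_ind: fs p => [|fs f IH] p.
  by rewrite seq_smul_nil SR_pi_eq0.
rewrite seq_smul_rcons size_rcons /= nth_rcons ltnn eqxx.
have ext x : extend (nth 0 (rcons fs f)) (fun=> True) (in_SR_ideal (K := K) D) (size fs) x <->
    extend (nth 0 fs) (fun=> True) (in_SR_ideal D) (size fs) x.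
  have : forall i, (i < size fs)%N -> nth 0 (rcons fs f) i = nth 0 fs i.
    by move=> i ifs; rewrite nth_rcons ifs.
  elim: (size fs) x => [//|j IHj] x e /=.
  have IHj' y := IHj y (fun i ij => e i (ltnW ij)).
  by split=> -[y [r [/IHj' Ey _ ->]]]; exists y, r; rewrite e.
split=> [[z [w [Qz E]]]|[y [r [/ext/IH Ey _ ->]]]].
  have [z' zE] := modquot_pi_surj z; have [w' wE] := modquot_pi_surj w.
  exists (p - f * w'), w'; split; rewrite ?subrK //; apply/ext/IH.
  rewrite linearB /= E wE -[f * w']/(f *: (w' : R^o)) linearZ /=.
  by rewrite addrK.
exists (modquot_pi (@SR_ideal K X D) y), (modquot_pi (@SR_ideal K X D) r).
by rewrite linearD -linearZ.
Qed.

Lemma interval_built_depth t r D : set0 \in D -> interval_built t r D ->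
  exists fs : seq R, [/\ forall f, f \in fs -> irrelevant_ideal f,
    regular_sequence (SR_module K D) fs & size fs = t].
Proof.
move=> D0 built; have Dc := interval_built_complex built.
have irr j : irrelevant_ideal (@elem_sym K n j).
  rewrite /irrelevant_ideal /elem_sym; apply/eqP/negPn/negP => e0.
  have hom : is_homogeneous j.+1%:Z (mesym n K j.+1) := dhomog_mesym n K j.+1.
  by have /is_homogeneousP/(_ _ e0) := hom; rewrite mdeg0.
exists (mkseq (@elem_sym K n) t); split; last by rewrite size_mkseq.
  by move=> f /mapP[j _ ->].
have extE j p : (j <= t)%N ->
  seq_smul (take j (mkseq (@elem_sym K n) t)) (modquot_pi (@SR_ideal K X D) p) <->
    extend (@elem_sym K n) (fun=> True) (mono_ideal (nonface D)) j p.
  move=> jt; rewrite seq_smul_extend size_takel ?size_mkseq //.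
  have : forall i, (i < j)%N -> nth 0 (take j (mkseq (@elem_sym K n) t)) i = @elem_sym K n i.
    by move=> i ij; rewrite nth_take // nth_mkseq // (leq_trans ij).
  elim: j {jt} p (take j _) => [|j IH] p fs e /=; first exact: in_SR_idealE.
  have IHj y := IH y fs (fun i ij => e i (ltnW ij)).
  by split=> -[y [r' [/IHj Ey _ ->]]]; exists y, r'; rewrite e.
split=> [j|].
  rewrite size_mkseq => jt m; have [p ->] := modquot_pi_surj m.
  rewrite nth_mkseq // -linearZ => /(extE _ _ (ltnW jt)) E; apply/(extE _ _ (ltnW jt)).
  exact: (interval_built_regular built jt I E).
exists (modquot_pi (@SR_ideal K X D) 1); rewrite -[mkseq _ _]take_size size_mkseq.
move/(extE _ _ (leqnn t)) => E.
suff: irrelevant_ideal (1 : R) by rewrite /irrelevant_ideal mcoeff1 eqxx => /eqP; rewrite oner_eq0.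
elim: t {built extE} (1 : R) E => [|t IH] p /=.
  by move/(in_SR_idealE _ Dc); apply: SR_ideal_irrelevant.
move=> [y [r' [/IH y0 _ ->]]]; rewrite /irrelevant_ideal mcoeffD y0 add0r rmorphM /=.
by rewrite irr mul0r.
Qed.

End NonFaces.

(** * Nonzero Koszul classes *)

Section NonVanishing.
Variables (K : fieldType) (X : finType) (D : {set {set X}}).
Hypothesis Dc : is_complex D.
Local Notation n := #|X|.
Local Notation R := {mpoly K[n]}.
Implicit Types (A B Q U W : {set X}) (x y : X) (S : {set 'I_n}) (m : 'X_{1..n}).

Lemma mcoeff_kdiff (c : {set 'I_n} -> R^o) S m :
  (kdiff c S)@_m = \sum_(u | u \notin S)
    (-1) ^+ #|[set w in S | (w < u)%N]| * (if m u != 0%N then (c (u |: S))@_(m - U_(u)) else 0).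
Proof.
rewrite raddf_sum; apply: eq_bigr => u _ /=.
rewrite -[_ *: c _]/(ksign K u S * 'X_u * c (u |: S)) -mulrA /ksign.
have <- : ('X_u * c (u |: S))@_m = if m u != 0%N then (c (u |: S))@_(m - U_(u)) else 0.
  by rewrite mcoeff_XM lep1mP.
by rewrite -signr_odd -[in RHS]signr_odd; case: odd; rewrite ?expr0 ?mul1r ?expr1 ?mulN1r ?mcoeffN.
Qed.

Lemma mset_rankD1 A x : x \in A -> (mset A - U_(enum_rank x))%MM = mset (A :\ x).
Proof.
move=> xA; apply/mnmP => i; rewrite mnmBE mnm1E -(enum_valK i) !msetE !inE.
rewrite (inj_eq enum_rank_inj) eq_sym; case: eqP => [->|_]; by rewrite ?xA ?subn0.
Qed.

Lemma mset1 x : mset [set x] = U_(enum_rank x)%MM.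
Proof. by rewrite /mset big_set1. Qed.

(** The class of [x_(A - v)] tensor the exterior monomial on [v |: B]. Were it a
    boundary, the coefficient of [x_A] in a second differential would be [1]. *)
Lemma SR_exact_minimal_nonface A B v : A \notin D -> v \in A ->
  (forall w, w \in A -> A :\ w \in D) -> [disjoint A & B] ->
  (forall u, u \in B -> u |: (A :\ v) \notin D) ->
  ~ SR_exact K D #|B|.+1 (#|A|%:Z - 1).
Proof.
move=> AD vA AwD disAB BD ex.
have cA : #|A| = #|A :\ v|.+1 by rewrite (cardsD1 v A) vA.
have vB : v \notin B by rewrite (disjointFr disAB vA).
pose rk (C : {set X}) := enum_rank @: C.
pose c S : R^o := (if S == rk (v |: B) then 'X_[mset (A :\ v)] else 0 : R).
have Mmod := mono_ideal_submodule K (upward_nonface Dc); have [M0 MD MZ] := Mmod.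
have rkU x C : enum_rank x |: rk C = rk (x |: C) by rewrite /rk imsetU1.
have [S cS|S [cS]|c' [_ c'E]] := ex c.
- rewrite /c; case: ifP => _; last exact: is_homogeneous0.
  by rewrite cA -addn1 PoszD addrK -(mdeg_mset (A :\ v)); apply: is_homogeneousX.
- apply/(in_SR_idealE _ Dc); apply: (big_ind (mono_ideal (nonface D))) => // u uS.
  rewrite /c; case: eqP => [E|_]; last by rewrite scaler0.
  have : u \in rk (v |: B) by rewrite -E setU11.
  case/imsetP => x xvB ux; rewrite -scalerA; apply: MZ.
  rewrite [_ *: _](_ : _ = 'X_[(U_(u) + mset (A :\ v))%MM]); last by rewrite mpolyXD.
  apply: mono_ideal_X; rewrite /nonface msupportD ux -mset1 !msupport_mset.
  by move: xvB; rewrite inE => /orP[/set1P ->|/BD//]; rewrite setD1K.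
pose e S : R^o := c S - kdiff c' S.
have eM S : #|S| = #|B|.+1 -> mono_ideal (nonface D) (e S).
  by move=> cS; apply/(in_SR_idealE _ Dc)/c'E.
have crk : #|rk B| = #|B| by rewrite (card_imset _ enum_rank_inj).
have : (kdiff c (rk B))@_(mset A) = (kdiff e (rk B))@_(mset A).
  by rewrite /e kdiffB kdiff_kdiff subr0.
have vrk : enum_rank v \notin rk B.
  by apply: contra vB => /imsetP[y yB /enum_rank_inj ->].
rewrite !mcoeff_kdiff (bigD1 (enum_rank v)) //= [X in _ + X]big1 ?addr0; last first.
  move=> u /andP[uB uv]; rewrite /c.
  case: (_ =P rk (v |: B)) => [E|_]; last by rewrite mcoeff0 if_same mulr0.
  have : u \in rk (v |: B) by rewrite -E setU11.
  by rewrite -rkU inE (negbTE uB) orbF => /set1P uE; rewrite uE eqxx in uv.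
rewrite msetE vA /= mset_rankD1 // /c rkU eqxx mcoeffX eqxx mulr1 big1; last first.
  move=> u uB; rewrite -(enum_valK u) msetE.
  case: (boolP (_ \in A)) => uA /=; last by rewrite mulr0.
  rewrite mset_rankD1 //; set y := (e _)@_ _; have -> : y = 0; last by rewrite mulr0.
  apply/eqP/negPn/negP => /(eM _ _).
  rewrite /nonface msupport_mset AwD // enum_valK cardsU1 uB crk.
  by move=> /(_ erefl).
by move/eqP; rewrite signr_eq0.
Qed.

(** A disconnection of the vertices outside [Q] gives a class in the strand of
    zeroth reduced cohomology: the differential of the exterior monomial on
    [~: Q], restricted to the terms of one side [U]. *)
Lemma SR_exact_disconnected Q U u0 w0 i : u0 \in U -> w0 \notin U -> w0 \notin Q ->
  [disjoint U & Q] -> #|~: Q| = i.+1 -> (forall x, x \notin Q -> [set x] \in D) ->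
  (forall x y, x \in U -> y \notin U -> y \notin Q -> [set x; y] \notin D) ->
  ~ SR_exact K D i 1.
Proof.
move=> u0U w0U w0Q disUQ cQ QD edge ex.
pose rk (C : {set X}) := enum_rank @: C.
have memrk x C : (enum_rank x \in rk C) = (x \in C).
  by rewrite /rk (mem_imset _ _ enum_rank_inj).
pose W := rk (~: Q); pose e0 S : R^o := (if S == W then 1 else 0 : R).
have cW : #|W| = i.+1 by rewrite (card_imset _ enum_rank_inj).
pose part (P : pred 'I_n) S : R^o :=
  \sum_(u | (u \notin S) && P u) (ksign K u S * 'X_u) *: e0 (u |: S).
pose c := part (fun u => u \in rk U); pose c2 := part (fun u => u \notin rk U).
have cc2 S : kdiff e0 S = c S + c2 S by rewrite /kdiff (bigID (fun u => u \in rk U)).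
have part_meets (P : pred 'I_n) (V : {set 'I_n}) S : (forall u, P u -> u \in W -> u \in V) ->
    mono_ideal (meets V) (part P S).
  move=> PV; have [V0 VD VZ] := mono_ideal_submodule K (@upward_meets n V).
  apply: (big_ind (mono_ideal (meets V))) => // u /andP[uS Pu].
  rewrite /e0; case: eqP => [E|_]; last by rewrite scaler0.
  have uW : u \in W by rewrite -E setU11.
  rewrite [_ *: _]mulr1; apply: VZ; apply: mono_ideal_X; exists u; first exact: PV.
  by rewrite mnm1E eqxx.
have meets_kdiff V b S : (forall T, mono_ideal (meets V) (b T)) ->
    mono_ideal (meets V) (kdiff (L := R^o) b S).
  move=> bV; apply: (submod_kdiff (mono_ideal_submodule K (@upward_meets n V))) => T _; exact: bV.
(* The monomials of [kdiff c] meet [U]; as [kdiff c = - kdiff c2] they meet the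
   other side too, so they contain a non-edge and [c] is a cycle. *)
have [S cS|S cS|c' [_ c'E]] := ex c.
- apply: is_homogeneous_sum => u _; rewrite /e0.
  case: ifP => _; last by rewrite scaler0; exact: is_homogeneous0.
  by rewrite [_ *: _]mulr1; exact: is_homogeneous_ksign.
- apply/(in_SR_idealE _ Dc) => m cm.
  have [u uU mu] : meets (rk U) m.
    by apply: (meets_kdiff _ c S) cm => T; apply: part_meets.
  have [w wU mw] : meets (W :\: rk U) m.
    apply: (meets_kdiff _ c2 S) => [T|]; first by apply: part_meets => x; rewrite !inE => -> ->.
    have -> : kdiff c2 S = - kdiff c S.
      apply/eqP; rewrite -addr_eq0 addrC -kdiffD -[X in _ == X](kdiff_kdiff e0 S); apply/eqP.
      by apply: eq_kdiff => T _; rewrite cc2.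
    by rewrite mcoeffN oppr_eq0.
  rewrite -(enum_valK u) memrk in uU; rewrite -(enum_valK w) inE !memrk inE in wU.
  case/andP: wU => wU wQ; apply: contra (edge _ _ uU wU wQ) => mD.
  by apply: Dc mD _; apply/subsetP => x /set2P[] ->; rewrite inE enum_valK.
(* Only the constant term of [c' W] contributes to the coefficient of [x]. *)
have key x : x \notin Q -> (c' W)@_0 = (x \in U)%:R :> K.
  move=> xQ; have xW : enum_rank x \in W by rewrite memrk inE.
  pose S := W :\ enum_rank x; have SW : enum_rank x |: S = W by rewrite setD1K.
  have cS : #|S| = i by move: cW; rewrite (cardsD1 (enum_rank x) W) xW => -[].
  have xS : enum_rank x \notin S by rewrite !inE eqxx.
  have other u : u \notin S -> u != enum_rank x -> (U_(enum_rank x)%MM : 'X_{1..n}) u = 0%N.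
    by move=> _ ux; rewrite mnm1E eq_sym (negbTE ux).
  have : (c S - kdiff c' S)@_(U_(enum_rank x)) = 0.
    apply/eqP/negPn/negP; have /(in_SR_idealE _ Dc) eM := c'E S cS.
    by move/eM; rewrite /nonface -mset1 msupport_mset QD.
  have sgn : (-1) ^+ #|[set w in S | (w < enum_rank x)%N]| != 0 :> K by rewrite signr_eq0.
  rewrite mcoeffB mcoeff_kdiff (bigD1 (enum_rank x)) //= [X in _ - (_ + X)]big1 ?addr0; last first.
    by move=> u /andP[uS ux]; rewrite (other u uS ux) mulr0.
  rewrite mnm1E eqxx /= SW (_ : (U_(enum_rank x) - U_(enum_rank x))%MM = 0%MM); last first.
    by apply/mnmP => u; rewrite mnmBE subnn mnm0E.
  rewrite (_ : (c S)@_U_(enum_rank x) =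
     (-1) ^+ #|[set w in S | (w < enum_rank x)%N]| * (x \in U)%:R); last first.
    pose eU T : R^o := (if (T == W) && (x \in U) then 1 else 0 : R).
    have -> : (c S)@_U_(enum_rank x) = (kdiff eU S)@_U_(enum_rank x).
      rewrite /c /part !raddf_sum big_mkcondr; apply: eq_bigr => u uS /=.
      have [->|ux] := eqVneq u (enum_rank x).
        rewrite memrk /eU SW eqxx /=; case: (x \in U); first by rewrite /e0 eqxx.
        by rewrite -[_ *: _]/(_ * 0) mulr0 mcoeff0.
      have z (p : R) : ((ksign K u S * 'X_u) *: (p : R^o))@_U_(enum_rank x) = 0.
        rewrite -[_ *: _]/(ksign K u S * 'X_u * p) -mulrA mulrCA mcoeff_XM lep1mP.
        by rewrite (other u uS ux).
      by rewrite !z if_same.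
    rewrite mcoeff_kdiff (bigD1 (enum_rank x)) //= [X in _ + X]big1 ?addr0; last first.
      by move=> u /andP[uS ux]; rewrite (other u uS ux) mulr0.
    rewrite mnm1E eqxx /= SW (_ : (U_(enum_rank x) - U_(enum_rank x))%MM = 0%MM); last first.
      by apply/mnmP => u; rewrite mnmBE subnn mnm0E.
    by rewrite /eU eqxx /=; case: (x \in U); rewrite ?mcoeff1 ?eqxx ?mcoeff0.
  by rewrite -mulrBr => /eqP; rewrite mulf_eq0 (negbTE sgn) subr_eq0 => /eqP.
have u0Q : u0 \notin Q by rewrite (disjointFr disUQ u0U).
have := key u0 u0Q; rewrite (key w0 w0Q) u0U (negbTE w0U) => /eqP.
by rewrite eq_sym oner_eq0.
Qed.

End NonVanishing.

(** * Skeleta of a complex with a leaf order *)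

Section Skeleta.
Variables (X : finType).
Implicit Types (D : {set {set X}}) (A B F G S Q U W : {set X}) (x y u v w : X).

Definition skel (l : nat) G S : {set {set X}} :=
  [set A : {set X} | [&& G \subset A, A \subset S & (#|A| <= l)%N]].

(** Split along a vertex [v] of [S]: first the faces that avoid [v], then
    those that contain it, until the interval has no room left. *)
Lemma interval_built_skel t r l G S D : interval_built t r D ->
  G \subset S -> (#|G| <= l)%N -> (t <= minn l #|S|)%N ->
  (if (#|S| <= l)%N then (#|G| <= r)%N else (l <= r)%N) ->
  [disjoint D & skel l G S] -> is_complex (D :|: skel l G S) ->
  interval_built t r (D :|: skel l G S).
Proof.
move cE : #|S :\: G| => c; elim: c G S D cE => [|c IH] G S D cE built GS Gl tS Sr dis cpx.
  have eGS : S = G.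
    by apply/eqP; rewrite eqEsubset GS andbT -setD_eq0 -cards_eq0 cE.
  have skE : skel l G S = face_interval G S.
    apply/setP => A; rewrite !inE; case: (boolP (G \subset A)) => //= _.
    case: (boolP (A \subset S)) => //= AS.
    by rewrite (leq_trans (subset_leq_card AS)) // eGS.
  rewrite skE in dis cpx *; apply: interval_builtU => //.
    by rewrite (leq_trans tS) // geq_minr.
  by move: Sr; rewrite eGS Gl.
have [Sl|lS] := leqP #|S| l.
  have skE : skel l G S = face_interval G S.
    apply/setP => A; rewrite !inE; case: (boolP (G \subset A)) => //= _.
    case: (boolP (A \subset S)) => //= AS.
    by rewrite (leq_trans (subset_leq_card AS)).
  rewrite skE in dis cpx *; rewrite Sl in Sr; apply: interval_builtU => //.
  by rewrite (leq_trans tS) // geq_minr.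
rewrite leqNgt lS /= in Sr.
have tl : (t <= l)%N by rewrite (leq_trans tS) // geq_minl.
move: Gl; rewrite leq_eqVlt => /orP[/eqP Gl|Gl].
  have skE : skel l G S = face_interval G G.
    apply/setP => A; rewrite !inE -eqEsubset; apply/and3P/eqP => [[GA AS Al]|<-].
      by apply/eqP; rewrite eqEcard GA Gl.
    by rewrite subxx GS Gl.
  rewrite skE in dis cpx *; apply: interval_builtU; rewrite ?Gl //.
have /card_gt0P[v] : (0 < #|S :\: G|)%N by rewrite cE.
rewrite inE => /andP[vG vS].
have skE : skel l G S = skel l G (S :\ v) :|: skel l (v |: G) S.
  apply/setP => A; rewrite !inE subUset sub1set subsetD1.
  by case: (v \in A); rewrite ?andbT ?andbF ?orbF.
have dis1 : [disjoint D & skel l G (S :\ v)].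
  by move: dis; rewrite -!setI_eq0 skE setIUr setU_eq0 => /andP[].
have dis2 : [disjoint D & skel l (v |: G) S].
  by move: dis; rewrite -!setI_eq0 skE setIUr setU_eq0 => /andP[].
have built1 : interval_built t r (D :|: skel l G (S :\ v)).
  apply: IH => //.
  - have -> : (S :\ v) :\: G = (S :\: G) :\ v by rewrite !setDDl setUC.
    by move: cE; rewrite (cardsD1 v) inE vG vS => -[].
  - by rewrite subsetD1 GS.
  - exact: ltnW.
  - by rewrite leq_min tl /=; move: lS; rewrite (cardsD1 v S) vS add1n ltnS; apply: leq_trans.
  - by case: ifP => _ //; apply: leq_trans Sr; apply: ltnW.
  move=> A B; rewrite inE => /orP[AD BA|AS BA].
    by rewrite inE (interval_built_complex built AD BA).
  have := cpx A B; rewrite !inE in AS *; move: AS => /and3P[GA AS Al].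
  rewrite (subset_trans AS (subD1set _ _)) GA Al orbT => /(_ isT BA).
  by rewrite (subset_trans BA AS) => /orP[->//|/and3P[-> _ ->]]; rewrite orbT.
rewrite skE setUA; apply: IH => //.
- have -> : S :\: (v |: G) = (S :\: G) :\ v by rewrite !setDDl setUC.
  by move: cE; rewrite (cardsD1 v) inE vG vS => -[].
- by rewrite subUset sub1set vS.
- by rewrite cardsU1 vG.
- by rewrite leqNgt lS.
- rewrite -setI_eq0 setIUl setU_eq0 !setI_eq0 dis2 andTb.
  apply/pred0P => A /=; rewrite !inE subsetD1 subUset sub1set.
  by case: (v \in A); rewrite ?andbF.
by rewrite -setUA -skE.
Qed.

Section LeafOrder.
Variables (s : nat -> {set X}) (e : nat).
Hypotheses (e_gt1 : (1 < e)%N)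
  (antichain : forall i j, (i < e)%N -> (j < e)%N -> s i \subset s j -> i = j)
  (leaf : forall m, (0 < m < e)%N -> exists2 p, (p < m)%N &
    forall i, (i < m)%N -> s m :&: s i \subset s p).

Definition initial m : {set X} := \bigcup_(i < m) s i.

Definition initial_skel l m : {set {set X}} :=
  [set A : {set X} | [exists i : 'I_m, A \subset s i] && (#|A| <= l)%N].

Lemma initialP m x : reflect (exists2 i, (i < m)%N & x \in s i) (x \in initial m).
Proof.
apply: (iffP bigcupP) => [[i _ xi]|[i im xi]]; first by exists i.
by exists (Ordinal im).
Qed.

Lemma initial_skelP l m A :
  reflect ((exists2 i, (i < m)%N & A \subset s i) /\ (#|A| <= l)%N) (A \in initial_skel l m).
Proof.
rewrite inE; apply: (iffP andP) => -[].
  by move/existsP=> [i Ai] Al; split=> //; exists i.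
by case=> i im Ai Al; split=> //; apply/existsP; exists (Ordinal im).
Qed.

Lemma initial_skel_complex l m W : W \subset s m ->
  is_complex (initial_skel l m :|: skel l set0 W).
Proof.
move=> Wm A B; rewrite !in_setU => /orP[/initial_skelP[[i im Ai] Al] BA|].
  apply/orP; left; apply/initial_skelP; split; first by exists i; rewrite // (subset_trans BA).
  by rewrite (leq_trans (subset_leq_card BA)).
rewrite !inE !sub0set /= => /andP[AW Al] BA; apply/orP; right.
by rewrite (subset_trans BA) // (leq_trans (subset_leq_card BA)).
Qed.

Lemma initial_skelS l m : initial_skel l m.+1 = initial_skel l m :|: skel l set0 (s m).
Proof.
apply/setP => A; rewrite in_setU; apply/initial_skelP/orP.
  case=> -[i]; rewrite ltnS leq_eqVlt => /orP[/eqP ->|im] Ai Al.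
    by right; rewrite !inE sub0set Ai.
  by left; apply/initial_skelP; split=> //; exists i.
case=> [/initial_skelP[[i im Ai] Al]|]; first by split=> //; exists i => //; apply: ltnW.
by rewrite !inE sub0set /= => /andP[Am Al]; split=> //; exists m.
Qed.

Variables (t r l c : nat).
Hypotheses (tl : (t <= l)%N) (tc : (t <= c.+1)%N)
  (sep_card : forall m, (0 < m < e)%N -> (c <= #|initial m :&: s m|)%N)
  (r_gt0 : (0 < l)%N -> (0 < r)%N)
  (r_ge : forall i, (i < e)%N -> (l < #|s i|)%N -> (l <= r)%N).

Lemma facet_card i : (i < e)%N -> (c < #|s i|)%N.
Proof.
move=> ie; have [i0|i0] := posnP i; last first.
  have i_lt : (0 < i < e)%N by rewrite i0.
  have [p lt_pi sp] := leaf i_lt; apply: leq_ltn_trans (sep_card i_lt) _.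
  apply: proper_card; rewrite properE subsetIr /=; apply/negP => sub.
  suff ip : i = p by rewrite ip ltnn in lt_pi.
  apply: antichain => //; first exact: ltn_trans lt_pi ie.
  apply/subsetP => x xi; have := subsetP sub x xi; rewrite inE => /andP[/initialP[j ji xj] _].
  by apply: (subsetP (sp j ji)); rewrite inE xi.
rewrite i0; have lt1 : (0 < 1 < e)%N by rewrite e_gt1.
apply: leq_ltn_trans (sep_card lt1) _; apply: proper_card.
have -> : initial 1 = s 0 by rewrite /initial big_ord1.
rewrite properE subsetIl subsetI subxx /=; apply/negP => /(antichain (ltnW e_gt1) e_gt1).
by [].
Qed.

(** The facets are added in the leaf order, and the vertices of each one that
    lie outside its separator [Q] one at a time: the new faces on
    [Q, v_1, ..., v_j] are those that contain [v_j]. *)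
Lemma interval_built_initial_skel m : (0 < m <= e)%N -> interval_built t r (initial_skel l m).
Proof.
elim: m => [//|m IH] /andP[_ me].
have [m0|m0] := posnP m.
  have -> : initial_skel l m.+1 = set0 :|: skel l set0 (s 0).
    rewrite m0 initial_skelS; congr (_ :|: _); apply/setP => A; rewrite [RHS]inE.
    by apply/initial_skelP => -[[]].
  have Z0 : initial_skel l 0 = set0.
    by apply/setP => A; rewrite [RHS]inE; apply/initial_skelP => -[[]].
  apply: interval_built_skel; rewrite ?sub0set ?cards0 //.
  - exact: interval_built0.
  - by rewrite leq_min tl (leq_trans tc) // facet_card // ltnW.
  - by case: leqP => // /r_ge; apply; apply: ltnW.
  - by rewrite -setI_eq0 set0I.
  by rewrite -Z0; apply: initial_skel_complex.
have me' : (0 < m < e)%N by rewrite m0.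
have [p pm sp] := leaf me'; pose Q := initial m :&: s m.
have memQ x : x \in Q = (x \in s m) && (x \in initial m) by rewrite inE andbC.
have Qp : Q \subset s p.
  apply/subsetP => x; rewrite memQ => /andP[xm /initialP[i im xi]].
  by apply: (subsetP (sp i im)); rewrite inE xm.
have built := IH (introT andP (conj m0 (ltnW me))).
suff : forall W, Q \subset W -> W \subset s m ->
    interval_built t r (initial_skel l m :|: skel l set0 W).
  by move/(_ (s m) (subsetIr _ _) (subxx _)); rewrite -initial_skelS.
move=> W; move cE : #|W :\: Q| => k; elim: k W cE => [|k IHk] W cE QW Wm.
  have -> : initial_skel l m :|: skel l set0 W = initial_skel l m; last by [].
  apply/setUidPl/subsetP => A; rewrite !inE sub0set /= => /andP[AW Al].
  apply/andP; split=> //; apply/existsP; exists (Ordinal pm) => /=.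
  apply: subset_trans AW (subset_trans _ Qp).
  by rewrite -setD_eq0 -cards_eq0 cE.
have /card_gt0P[v] : (0 < #|W :\: Q|)%N by rewrite cE.
rewrite inE => /andP[vQ vW].
have builtW' : interval_built t r (initial_skel l m :|: skel l set0 (W :\ v)).
  apply: IHk.
  - have -> : (W :\ v) :\: Q = (W :\: Q) :\ v by rewrite !setDDl setUC.
    by move: cE; rewrite (cardsD1 v) inE vQ vW => -[].
  - by rewrite subsetD1 QW.
  by rewrite (subset_trans (subD1set _ _)).
have skE : initial_skel l m :|: skel l set0 W =
    initial_skel l m :|: skel l set0 (W :\ v) :|: skel l [set v] W.
  rewrite -setUA; congr (_ :|: _); apply/setP => A; rewrite !inE !sub0set sub1set subsetD1 /=.
  by case: (v \in A); rewrite ?andbT ?andbF ?orbF.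
have [l0|l0] := posnP l.
  have -> : initial_skel l m :|: skel l set0 W =
    initial_skel l m :|: skel l set0 (W :\ v); last by [].
  rewrite skE; apply/setUidPl/subsetP => A; rewrite inE sub1set l0 leqn0 cards_eq0.
  by case/and3P=> vA _ /eqP A0; rewrite A0 inE in vA.
rewrite skE; apply: interval_built_skel => //; rewrite ?sub1set ?cards1 //.
- rewrite leq_min tl (leq_trans tc) // -add1n.
  have : (#|v |: Q| <= #|W|)%N by apply: subset_leq_card; rewrite subUset sub1set vW.
  rewrite cardsU1 vQ; apply: leq_trans; rewrite leq_add2l; exact: sep_card.
- case: (leqP #|W| l) => [_|lW]; first exact: r_gt0.
  by apply: (r_ge me); apply: leq_trans lW (subset_leq_card Wm).
- apply/pred0P => A /=; rewrite in_setU; apply/negP => /andP[AD].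
  rewrite inE sub1set => /and3P[vA AW _]; case/orP: AD.
    case/initial_skelP=> -[i im Ai] _; case/negP: vQ; rewrite memQ (subsetP Wm) //=.
    by apply/initialP; exists i => //; apply: (subsetP Ai).
  by rewrite inE subsetD1 vA !andbF.
by rewrite -skE; apply: initial_skel_complex.
Qed.

End LeafOrder.
End Skeleta.

Section SeparatorDisconnects.
Variables (X : finType) (s : nat -> {set X}) (e : nat).
Hypotheses (antichain : forall i j, (i < e)%N -> (j < e)%N -> s i \subset s j -> i = j)
  (leaf : forall m, (0 < m < e)%N -> exists2 p, (p < m)%N &
    forall i, (i < m)%N -> s m :&: s i \subset s p).
Implicit Types (x y : X) (U Q : {set X}).

(** Removing the separator of the [m]-th facet disconnects the complex: the side
    [U] of that facet is grown along the leaf order, a later facet joining the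
    side of the facet it is attached to. *)
Lemma separator_disconnects m Q : (0 < m < e)%N -> Q = initial s m :&: s m ->
  exists U u w, [/\ u \in U, w \notin U, w \notin Q, [disjoint U & Q] &
    forall i x y, (i < e)%N -> x \in s i -> y \in s i -> x \in U -> y \notin U -> y \in Q].
Proof.
move=> me QE; have /andP[m0 lt_me] := me.
have [p lt_pm sp] := leaf me.
have memQ x : (x \in Q) = (x \in s m) && (x \in initial s m) by rewrite QE inE andbC.
suff grow : forall j, (m < j <= e)%N -> exists U u w,
   [/\ u \in U, w \in initial s j, w \notin U, w \notin Q &
    [/\ [disjoint U & Q], U \subset initial s j &
    forall i, (i < j)%N -> s i :\: Q \subset U \/ [disjoint s i & U]]].
  have [|U [u [w [uU _ wU wQ [dis _ side]]]]] := grow e; first by rewrite lt_me leqnn.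
  exists U, u, w; split=> // i x y ie xi yi xU yU; case: (side i ie) => [sub|].
    by apply: contraNT yU => yQ; apply: (subsetP sub); rewrite inE yQ.
  by move/pred0P/(_ x); rewrite /= xi xU.
elim=> [//|j IH] /andP[]; rewrite ltnS leq_eqVlt => /orP[/eqP <- {j IH} _|mj je].
  have [u um uQ] : exists2 u, u \in s m & u \notin Q.
    apply/subsetPn; apply/negP => sub; suff E : m = p by rewrite E ltnn in lt_pm.
    apply: antichain => //; first exact: ltn_trans lt_pm lt_me.
    apply/subsetP => x xm; have := subsetP sub x xm; rewrite memQ => /andP[_ /initialP[i im xi]].
    by apply: (subsetP (sp i im)); rewrite inE xm.
  have [w w0 wQ] : exists2 w, w \in s 0 & w \notin Q.
    apply/subsetPn; apply/negP => sub; suff E : 0%N = m by rewrite -E in m0.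
    apply: antichain => //; first exact: ltn_trans m0 lt_me.
    by apply: subset_trans sub _; rewrite QE subsetIr.
  have winit : w \in initial s m by apply/initialP; exists 0%N.
  exists (s m :\: Q), u, w; split=> //.
  - by rewrite inE uQ.
  - by apply/initialP; exists 0%N.
  - by rewrite inE wQ /=; apply: contra wQ => wm; rewrite memQ wm.
  split.
  - by rewrite -setI_eq0; apply/eqP/setP => x; rewrite !inE; case: (x \in Q); rewrite ?andbF.
  - by apply/subsetP => x; rewrite inE => /andP[_ xm]; apply/initialP; exists m.
  move=> i; rewrite ltnS leq_eqVlt => /orP[/eqP ->|im]; first by left.
  right; apply/pred0P => x /=; apply/negP => /andP[xi]; rewrite inE memQ => /andP[xQ xm].
  by case/negP: xQ; rewrite xm /=; apply/initialP; exists i.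
have [|U [u [w [uU winit wU wQ [dis Uinit side]]]]] := IH; first by rewrite mj ltnW.
have initS x : x \in initial s j -> x \in initial s j.+1.
  by case/initialP=> i ij xi; apply/initialP; exists i => //; apply: ltnW.
have [|q lt_qj sq] := leaf (m := j); first by rewrite je andbT (leq_ltn_trans _ mj).
case: (side q lt_qj) => [qU|qU].
  exists (U :|: (s j :\: (Q :|: initial s j))), u, w; split=> //.
  - by rewrite inE uU.
  - exact: initS.
  - by rewrite !inE negb_or wU winit orbT.
  split.
  - rewrite -setI_eq0 setIUl; apply/eqP/setP => x; rewrite !inE.
    by case: (boolP (x \in Q)) => [xQ|]; rewrite ?andbF ?orbF // (disjointFl dis xQ).
  - apply/subsetP => x; rewrite !inE => /orP[/(subsetP Uinit)/initS//|/andP[_ xj]].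
    by apply/initialP; exists j.
  move=> i; rewrite ltnS leq_eqVlt => /orP[/eqP ->|ij].
    left; apply/subsetP => x; rewrite !inE => /andP[xQ xj]; rewrite (negbTE xQ) xj andbT /=.
    case: (boolP (x \in initial s j)) => [/initialP[i' ij xi]|]; last by rewrite orbT.
    rewrite orbF; apply: (subsetP qU); rewrite inE xQ.
    by apply: (subsetP (sq i' ij)); rewrite inE xj.
  case: (side i ij) => [iU|iU]; first by left; apply: subset_trans iU (subsetUl _ _).
  right; apply/pred0P => x /=; rewrite !inE; apply/negP => /andP[xi /orP[xU|]].
    by rewrite (disjointFr iU xi) in xU.
  by rewrite negb_or => /andP[/andP[_ /negP]]; case; apply/initialP; exists i.
exists U, u, w; split=> //; first exact: initS.
split=> //; first by apply/subsetP => x /(subsetP Uinit)/initS.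
move=> i; rewrite ltnS leq_eqVlt => /orP[/eqP ->|]; last exact: side.
right; apply/pred0P => x /=; apply/negP => /andP[xj xU].
have /initialP[i' ij xi] := subsetP Uinit x xU.
by rewrite (disjointFr qU) // in xU; apply: (subsetP (sq i' ij)); rewrite inE xj.
Qed.

End SeparatorDisconnects.

Section Invariants.
Variables (K : fieldType) (X : finType) (D : {set {set X}}).

(** The regularity is the largest [q] with nonzero Koszul homology; the projective
    dimension [p] is the largest such [i], and the depth is its complement
    [#|X| - p], attained by elementary symmetric polynomials. *)
Lemma interval_built_invariants (t r : nat) (q : int) : set0 \in D -> interval_built t r D ->
  (t <= #|X|)%N -> ~ SR_exact K D (#|X| - t) q -> (exists i, ~ SR_exact K D i r%:Z) ->
  [/\ SR_is_reg K D r%:Z, SR_is_pdim K D (#|X| - t)%N%:Z & SR_is_depth K D t%:Z].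
Proof.
move=> D0 built tX nexp nexr; have Dc := interval_built_complex built.
have van i (z : int) : (#|X| < i + t)%N \/ r%:Z < z -> SR_exact K D i z.
  by move=> H; apply/(SR_exact_mono _ _ _ Dc); apply: interval_built_exact H.
have vanr i z : r%:Z < z -> SR_exact K D i z by move=> rz; apply: van; right.
have nex : ~ koszul_exact (#|X| - t) (fun=> True) (fun=> True) (fun x : SR_module K D => x = 0).
  move=> ex; apply: nexp; apply/SR_exact_piece.
  exact: (koszul_exact_weaken _ _ ex).
split.
- exact: SR_is_reg_intro D0 vanr nexr.
- split=> [|_ [l -> res]].
    exists (#|X| - t)%N => //; apply: (SR_projective_resolution D0 vanr) => i z li.
    by apply: van; left; rewrite -(subnK tX) ltn_add2r.
  rewrite lez_nat leqNgt; apply/negP => lt; apply: nex.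
  exact: koszul_exact_pdim res lt.
split=> [|_ [fs [irr reg ->]]].
  have [fs [irr reg sz]] := interval_built_depth K D0 built.
  by exists fs; split=> //; rewrite sz.
rewrite lez_nat leqNgt; apply/negP => lt; apply: nex; apply: (koszul_exact_regular irr reg).
by rewrite -[X in (X < _)%N](subnK tX) ltn_add2l.
Qed.

End Invariants.

Lemma bigmin_attained (N e : nat) (f : nat -> nat) :
  (0 < e)%N -> (forall m, (m < e)%N -> (f m <= N)%N) ->
  (exists2 m, (m < e)%N & f m = \big[minn/N]_(m < e) f m) /\
  forall m, (m < e)%N -> (\big[minn/N]_(m < e) f m <= f m)%N.
Proof.
move=> e0 fN; have [le att] : (forall m, (m < e)%N -> (\big[minn/N]_(m < e) f m <= f m)%N) /\
    (\big[minn/N]_(m < e) f m = N \/ exists2 m, (m < e)%N & f m = \big[minn/N]_(m < e) f m).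
  elim: e f {e0 fN} => [|e IH] f; first by rewrite big_ord0; split=> //; left.
  rewrite big_ord_recl /=; have [] := IH (fun m => f m.+1).
  move: (\big[minn/N]_(i < e) f i.+1) => b le att; split.
    by case=> [_|m me]; [exact: geq_minl|apply: leq_trans (geq_minr _ _) (le m me)].
  case: (leqP (f 0%N) b) => _; first by right; exists 0%N.
  by case: att => [->|[m me E]]; [left|right; exists m.+1].
split=> //; case: att => // E; exists 0%N => //.
by apply/eqP; rewrite eqn_leq le // E fN.
Qed.

Section Facets.
Variables (X : finType) (Delta : {set {set X}}).

Lemma facet_above A : A \in Delta -> exists2 F, F \in facets Delta & A \subset F.
Proof.
move=> AD; have [F Fmax AF] := maxset_exists (P := mem Delta) AD.
by exists F => //; rewrite inE.
Qed.

Lemma facets_antichain F G : F \in facets Delta -> G \in facets Delta -> F \subset G -> F = G.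
Proof.
rewrite !inE => /maxsetP[_ Fmax] /maxsetP[GD _] FG.
by rewrite (Fmax G).
Qed.

End Facets.

Lemma clique_complexP (X : finType) (adj : rel X) (A : {set X}) :
  reflect {in A &, forall x y, x != y -> adj x y} (A \in clique_complex adj).
Proof.
rewrite inE; apply: (iffP forall_inP) => H x.
  by move=> y xA yA xy; have /forall_inP/(_ y yA)/implyP := H x xA; apply.
by move=> xA; apply/forall_inP => y yA; apply/implyP; apply: H.
Qed.

Lemma clique_complex_complex (X : finType) (adj : rel X) : is_complex (clique_complex adj).
Proof.
move=> A B /clique_complexP Acl BA; apply/clique_complexP => x y xB yB.
by apply: Acl; apply: (subsetP BA).
Qed.

(** * The invariants of the skeleta *)

Lemma subset_of_card (X : finType) (F : {set X}) l : (l <= #|F|)%N ->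
  exists2 A : {set X}, A \subset F & #|A| = l.
Proof.
move=> lF; exists [set x in take l (enum F)].
  by apply/subsetP => x; rewrite inE => /mem_take; rewrite mem_enum.
rewrite cardsE (card_uniqP _) ?take_uniq ?enum_uniq // size_takel //.
by rewrite -cardE.
Qed.

Theorem theorem2 (K : fieldType) (X : finType) (adj : rel X)
  (adj_sym : symmetric adj) (adj_irr : irreflexive adj)
  (adj_chordal : chordal adj)
  (two_facets : (1 < #|facets (clique_complex adj)|)%N)
  (S : seq {set X}) (S_leaf : leaf_order (clique_complex adj) S) (k : int)
  (k_ge : -1 <= k) (k_le : k <= complex_dim (clique_complex adj)) :
  let Delta := clique_complex adj in
  let N := #|X|%:Z in
  let d := complex_dim Delta in
  let rmin := (r_min S)%:Z in
  [/\ SR_is_reg K (skeleton Delta k) (if k < d then k + 1 else 1),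
      SR_is_pdim K (skeleton Delta k)
        (if k <= rmin then N - k - 1 else N - rmin - 1) &
      SR_is_depth K (skeleton Delta k)
        (if k <= rmin then k + 1 else rmin + 1)].
Proof.
move=> Delta N d rmin.
have Dcpx : is_complex Delta := @clique_complex_complex X adj.
have [S_perm S_attach] := S_leaf.
pose s i := nth set0 S i; pose e := size S.
have e_gt1 : (1 < e)%N by rewrite /e (perm_size S_perm) -cardE.
have S_uniq : uniq S by rewrite (perm_uniq S_perm) enum_uniq.
have memS F : (F \in S) = (F \in facets Delta) by rewrite (perm_mem S_perm) mem_enum.
have s_facet i : (i < e)%N -> s i \in facets Delta by move=> ie; rewrite -memS mem_nth.
have s_face i : (i < e)%N -> s i \in Delta.
  by move/s_facet; rewrite inE => /maxsetP[].
have antichain i j : (i < e)%N -> (j < e)%N -> s i \subset s j -> i = j.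
  move=> ie je /(facets_antichain (s_facet i ie) (s_facet j je))/eqP.
  by rewrite nth_uniq // => /eqP.
have leaf m : (0 < m < e)%N -> exists2 p, (p < m)%N &
    forall i, (i < m)%N -> s m :&: s i \subset s p.
  move=> me; have [p pm sp] := S_attach m me; exists p => // i im.
  exact: subset_trans (sp i im) (subsetIr _ _).
pose c := r_min S.
have [[m0 m0e cE] c_le] := @bigmin_attained #|X| e.-1 (fun m => #|separator S m|)
   (ltac:(by case: (e) e_gt1 => [|[]])) (fun m _ => max_card _).
rewrite -/(r_min S) -/c in cE c_le.
have sep_card m : (0 < m < e)%N -> (c <= #|initial s m :&: s m|)%N.
  case: m => // m /andP[_ me]; apply: (c_le m).
  by move: me e_gt1; case: (e).
have facet_c := facet_card e_gt1 antichain leaf sep_card.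
pose M := (\max_(F in Delta) #|F|)%N.
have le_M F : F \in Delta -> (#|F| <= M)%N by move=> FD; apply: leq_bigmax_cond.
have [F0 F0D F0M] : exists2 F, F \in Delta & #|F| = M.
  have ne : (0 < #|Delta|)%N by apply/card_gt0P; exists (s 0%N); apply/s_face/ltnW.
  by have [F FD FE] := eq_bigmax_cond (fun F : {set X} => #|F|) ne; exists F.
have c_lt_M : (c < M)%N.
  by apply: leq_trans (le_M _ (s_face 0%N (ltnW e_gt1))); apply/facet_c/ltnW.
have dE : d = M%:Z - 1 by [].
(* [l] bounds the cardinality of the faces of the skeleton, so [k = l - 1]. *)
pose l := absz (k + 1)%R.
have kE : k = l%:Z - 1 by rewrite /l; lia.
have l_le_M : (l <= M)%N by move: k_le; rewrite -/Delta -/d dE kE; lia.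
pose t := minn l c.+1; pose r := if (l < M)%N then l else 1%N.
pose D := skeleton Delta k.
have memD A : (A \in D) = (A \in Delta) && (#|A| <= l)%N.
  by rewrite inE kE; congr (_ && _); apply/idP/idP; lia.
have DE : D = initial_skel s l e.
  apply/setP => A; rewrite memD; apply/andP/initial_skelP => -[AD Al]; split=> //.
    have [F Ffac AF] := facet_above AD; rewrite -memS in Ffac.
    by exists (index F S); rewrite ?index_mem // /s nth_index.
  by case: AD => i ie Ai; apply: Dcpx Ai; apply: s_face.
have tl : (t <= l)%N by apply: geq_minl.
have tc : (t <= c.+1)%N by apply: geq_minr.
have built : interval_built t r D.
  rewrite DE; apply: (interval_built_initial_skel e_gt1 antichain leaf tl tc sep_card) => //.
  - by rewrite /r; case: ifP.
  - move=> i ie li; rewrite /r (leq_trans li) //.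
    exact/le_M/s_face.
  by rewrite leqnn andbT ltnW.
have D0 : set0 \in D.
  rewrite memD cards0 andbT; apply: Dcpx (s_face 0%N (ltnW e_gt1)) _; exact: sub0set.
have Dc := interval_built_complex built.
have tX : (t <= #|X|)%N.
  by apply: leq_trans tc (leq_trans (facet_c 0%N (ltnW e_gt1)) (max_card _)).
have sing x : [set x] \in Delta by apply/clique_complexP => y z /set1P -> /set1P ->; rewrite eqxx.
(* Below the dimension of the complex, any face with [l + 1] vertices is a
   minimal nonface of the skeleton. *)
have top_face : (l < M)%N -> exists (A : {set X}) v, [/\ #|A| = l.+1, v \in A, A \notin D &
    forall w, w \in A -> A :\ w \in D].
  rewrite -F0M => /subset_of_card[A AF cA].
  have /card_gt0P[v vA] : (0 < #|A|)%N by rewrite cA.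
  exists A, v; split=> //; first by rewrite memD cA ltnn andbF.
  move=> w wA; rewrite memD (Dcpx F0) ?(subset_trans (subD1set _ _)) //=.
  by move: cA; rewrite (cardsD1 w) wA add1n => -[->].
have nexr : exists i, ~ SR_exact K D i r%:Z.
  exists 1%N; have [lM|Ml] := ltnP l M.
    have [A [v [cA vA AD Aw]]] := top_face lM.
    have := SR_exact_minimal_nonface (K := K) Dc (B := set0) AD vA Aw.
    rewrite cards0 cA /r lM intS addrC addKr; apply; first by rewrite -setI_eq0 setI0.
    by move=> u; rewrite inE.
  (* At [k = d] a pair of vertices that are not adjacent is a minimal nonface. *)
  have [x [y [xy nadj]]] : exists x y, x != y /\ ~~ adj x y.
    case: (boolP [forall x, forall y, (x != y) ==> adj x y]) => [/forallP H|]; last first.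
      move=> /forallPn[x /forallPn[y]]; rewrite negb_imply => /andP[xy nadj].
      by exists x, y.
    have TD : [set: X] \in Delta.
      by apply/clique_complexP => x y _ _ xy; have /forallP/(_ y)/implyP := H x; apply.
    have : s 1%N \subset s 0%N.
      have := s_facet 0%N (ltnW e_gt1); rewrite inE => /maxsetP[_ /(_ _ TD (subsetT _)) <-].
      exact: subsetT.
    by move/(antichain 1%N 0%N e_gt1 (ltnW e_gt1)).
  have Aw w : w \in [set x; y] -> [set x; y] :\ w \in D.
    move=> wA; have : #|[set x; y] :\ w| == 1%N.
      by have := cards2 x y; rewrite (cardsD1 w) wA xy add1n => -[->].
    case/cards1P => z ->; rewrite memD sing cards1.
    exact: leq_trans (leq_ltn_trans (leq0n c) c_lt_M) Ml.
  have AD : [set x; y] \notin D.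
    rewrite memD negb_and; apply/orP; left; apply/negP => /clique_complexP/(_ x y).
    by rewrite !inE !eqxx orbT => /(_ isT isT xy); apply/negP.
  have := SR_exact_minimal_nonface (K := K) Dc (B := set0) AD (set21 x y) Aw.
  rewrite cards0 cards2 xy /r ltnNge Ml; apply; first by rewrite -setI_eq0 setI0.
  by move=> u; rewrite inE.
have nexp : exists q, ~ SR_exact K D (#|X| - t) q.
  have [lc|cl] := leqP l c.
    (* The facets of the skeleton in [A] have the largest possible size, so that
       the exterior factor may run over all vertices outside [A]. *)
    have [A [v [cA vA AD Aw]]] := top_face (leq_ltn_trans lc c_lt_M).
    exists (#|A|%:Z - 1); have -> : (#|X| - t)%N = #|~: A|.+1.
      have tlE : t = l by apply/minn_idPl; rewrite (leq_trans lc).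
      apply/eqP; rewrite -(eqn_add2r t) (subnK tX) tlE; apply/eqP.
      by rewrite -[LHS](cardsC A) cA addSn addSn addnC.
    apply: (SR_exact_minimal_nonface Dc AD vA Aw); first by rewrite -setI_eq0 setICr.
    move=> u; rewrite inE memD => uA; rewrite cardsU1 !inE (negbTE uA) andbF.
    by move: cA; rewrite (cardsD1 v) vA add1n => -[->]; rewrite ltnn andbF.
  (* A smallest separator disconnects the other vertices. *)
  have m0e' : (0 < m0.+1 < e)%N by move: m0e e_gt1; case: (e).
  have [U [u [w [uU wU wQ dis edge]]]] := separator_disconnects antichain leaf m0e' (erefl _).
  exists 1; apply: (SR_exact_disconnected Dc uU wU wQ dis).
  - have tcE : t = c.+1 by apply/minn_idPr.
    apply/eqP; rewrite -(eqn_add2r c) addSnnS -tcE (subnK tX) -cE addnC.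
    exact/eqP/cardsC.
  - move=> x _; rewrite memD sing cards1; exact: leq_trans cl.
  move=> x y xU yU yQ; rewrite memD negb_and; apply/orP; left; apply/negP => xyD.
  have [F Ffac xyF] := facet_above xyD; rewrite -memS in Ffac.
  case/negP: yQ; apply: (edge (index F S) x y) => //; rewrite ?index_mem // /s nth_index //.
    by apply: (subsetP xyF); rewrite !inE eqxx.
  by apply: (subsetP xyF); rewrite !inE eqxx orbT.
have [q nexq] := nexp.
have [regE pdimE depthE] := interval_built_invariants D0 built tX nexq nexr.
have rE : (if k < d then k + 1 else 1) = r%:Z.
  rewrite /r dE kE ltrD2r ltz_nat subrK; by case: ifP.
have tE : t%:Z = if k <= rmin then k + 1 else rmin + 1.
  rewrite /t /rmin -/c kE; case: ifP => h; first by rewrite subrK; congr Posz; apply/minn_idPl; lia.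
  by rewrite (_ : minn l c.+1 = c.+1); [lia|apply/minn_idPr; lia].
split.
- by rewrite rE.
- rewrite (_ : (if _ then _ else _) = (#|X| - t)%N%:Z) // -subzn // tE.
  by case: ifP => _; rewrite opprD addrA.
by rewrite -tE.
Qed.
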